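(* Let $E$ be an elliptic curve over $\mathbb{Q}$ whose Mordell–Weil group $E(\mathbb{Q})$ has rank $r\ge 2$, and let $\Gamma$ be a subgroup of $E(\mathbb{Q})$ of rank $s$ with $1\le s<r$. Then for every sufficiently large real $x$ there is a rational point $Q\in E(\mathbb{Q})$ with $$\hat{h}(Q)\le \exp\Big(\frac{4}{s+2}x+O(x/\log x)\Big)$$ such that $Q$ is an $x$-pseudolinearly dependent point of $\Gamma$.
   Context: For a prime $p$ of good reduction of $E$ (i.e. $p\nmid \Delta_E$), $\Gamma_p\subseteq E(\mathbb{F}_p)$ denotes the image of $\Gamma$ under reduction modulo $p$. A point $Q\in E(\mathbb{Q})$ is an $x$-pseudolinearly dependent point of $\Gamma$ if $Q\notin\Gamma$ but, for every prime $p\le x$ of good reduction, the reduction of $Q$ modulo $p$ lies in $\Gamma_p$. $\hat{h}$ denotes the canonical (Néron–Tate) height on $E(\mathbb{Q})$. The implied constant in $O$ depends only on $E$ and $\Gamma$. *)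

(* Defs.v *)
From HB Require Import structures.
From mathcomp Require Import all_boot all_order all_algebra.
From mathcomp Require Import ring.
From mathcomp Require Import all_classical all_reals all_analysis.

Set Implicit Arguments.
Unset Strict Implicit.
Unset Printing Implicit Defensive.

Import Order.TTheory GRing.Theory Num.Theory.
Import numFieldNormedType.Exports.

Local Open Scope classical_set_scope.
Local Open Scope ring_scope.

(* The Weierstrass equation y^2 + a1 x y + a3 y = x^3 + a2 x^2 + a4 x + a6.
   Every elliptic curve over Q has such a model with integral coefficients
   (even a globally minimal one); it is elliptic when [disc] is nonzero. *)
Record weierstrass := Weierstrass { a1 : int; a2 : int; a3 : int; a4 : int; a6 : int }.

Definition b2 (E : weierstrass) : int := a1 E ^+ 2 + 4 * a2 E.
Definition b4 (E : weierstrass) : int := 2 * a4 E + a1 E * a3 E.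
Definition b6 (E : weierstrass) : int := a3 E ^+ 2 + 4 * a6 E.
Definition b8 (E : weierstrass) : int :=
  a1 E ^+ 2 * a6 E + 4 * a2 E * a6 E - a1 E * a3 E * a4 E
  + a2 E * a3 E ^+ 2 - a4 E ^+ 2.

Definition disc (E : weierstrass) : int :=
  - b2 E ^+ 2 * b8 E - 8 * b4 E ^+ 3 - 27 * b6 E ^+ 2 + 9 * b2 E * b4 E * b6 E.

Section Points.
Variables (F : fieldType) (E : weierstrass).

Local Notation A1 := ((a1 E)%:~R : F).
Local Notation A2 := ((a2 E)%:~R : F).
Local Notation A3 := ((a3 E)%:~R : F).
Local Notation A4 := ((a4 E)%:~R : F).
Local Notation A6 := ((a6 E)%:~R : F).

(* [None] is the point at infinity. *)
Definition on_curve (P : option (F * F)) : bool :=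
  if P is Some (x, y) then
    y ^+ 2 + A1 * x * y + A3 * y == x ^+ 3 + A2 * x ^+ 2 + A4 * x + A6
  else true.

Definition ec_point : Type := {P : option (F * F) | on_curve P}.

Definition zerop : ec_point := exist _ None isT.

Definition opp_raw (P : option (F * F)) : option (F * F) :=
  if P is Some (x, y) then Some (x, - y - A1 * x - A3) else None.

(* Chord-and-tangent law: the third intersection point of the line
   y = lam * x + nu with the curve has abscissa x3, and is then negated. *)
Definition add_raw (P Q : option (F * F)) : option (F * F) :=
  match P, Q with
  | None, _ => Q
  | _, None => P
  | Some (x1, y1), Some (x2, y2) =>
    if (x1 == x2) && (y1 + y2 + A1 * x2 + A3 == 0) then None else
    let lam := if x1 == x2
      then (3 * x1 ^+ 2 + 2 * A2 * x1 + A4 - A1 * y1) / (2 * y1 + A1 * x1 + A3)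
      else (y2 - y1) / (x2 - x1) in
    let nu := y1 - lam * x1 in
    let x3 := lam ^+ 2 + A1 * lam - A2 - x1 - x2 in
    Some (x3, - (lam + A1) * x3 - nu - A3)
  end.

Lemma opp_on_curve P : on_curve P -> on_curve (opp_raw P).
Proof. by case: P => [[x y]|//] /= /eqP h; apply/eqP; rewrite -h; ring. Qed.

Lemma add_on_curve P Q : on_curve P -> on_curve Q -> on_curve (add_raw P Q).
Proof.
case: P Q => [[x1 y1]|//] [[x2 y2]|//] /= /eqP hP /eqP hQ.
case: ifP => // hN.
set lam := (if _ then _ else _); set nu := y1 - lam * x1.
set x3 := lam ^+ 2 + _ - _ - _ - _.
pose g x := (lam * x + nu) ^+ 2 + A1 * x * (lam * x + nu) + A3 * (lam * x + nu)
            - (x ^+ 3 + A2 * x ^+ 2 + A4 * x + A6).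
have g1 : g x1 = 0.
  have e : lam * x1 + nu = y1 by rewrite /nu; ring.
  by rewrite /g e hP subrr.
suff g3 : g x3 = 0.
  by apply/eqP/subr0_eq; rewrite -g3 /g; ring.
have [e12|n12] := eqVneq x1 x2.
  have yy : y1 = y2.
    subst x2.
    have : (y1 - y2) * (y1 + y2 + A1 * x1 + A3) = 0.
      transitivity ((y1 ^+ 2 + A1 * x1 * y1 + A3 * y1)
                    - (y2 ^+ 2 + A1 * x1 * y2 + A3 * y2)); first by ring.
      by rewrite hP hQ subrr.
    move/eqP; rewrite mulf_eq0 subr_eq0 => /orP[/eqP //|h].
    by rewrite eqxx h in hN.
  subst x2 y2.
  have dn0 : 2 * y1 + A1 * x1 + A3 != 0.
    apply/negP => h; move: hN; rewrite eqxx /=.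
    by rewrite (_ : y1 + y1 = 2 * y1) ?h //; ring.
  have hl : lam * (2 * y1 + A1 * x1 + A3)
            = 3 * x1 ^+ 2 + 2 * A2 * x1 + A4 - A1 * y1.
    by rewrite /lam eqxx divfK.
  have -> : g x3 = g x1 + (lam * (2 * y1 + A1 * x1 + A3)
     - (3 * x1 ^+ 2 + 2 * A2 * x1 + A4 - A1 * y1)) * (x3 - x1).
    by rewrite /g /x3 /nu; ring.
  by rewrite g1 hl subrr mul0r addr0.
have d0 : x2 - x1 != 0 by rewrite subr_eq0 eq_sym.
have hl : lam * (x2 - x1) = y2 - y1.
  by rewrite /lam (negPf n12) divfK.
have g2 : g x2 = 0.
  have e : lam * x2 + nu = y2.
    transitivity (lam * (x2 - x1) + y1); first by rewrite /nu; ring.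
    by rewrite hl subrK.
  by rewrite /g e hQ subrr.
apply: (mulfI d0); rewrite mulr0.
transitivity ((x2 - x3) * g x1 + (x3 - x1) * g x2).
  by rewrite /g /x3; ring.
by rewrite g1 g2 !mulr0 addr0.
Qed.

Definition oppp (P : ec_point) : ec_point :=
  exist _ (opp_raw (sval P)) (opp_on_curve (svalP P)).

Definition addp (P Q : ec_point) : ec_point :=
  exist _ (add_raw (sval P) (sval Q)) (add_on_curve (svalP P) (svalP Q)).

Definition mulzp (n : int) (P : ec_point) : ec_point :=
  match n with
  | Posz k => iter k (addp P) zerop
  | Negz k => oppp (iter k.+1 (addp P) zerop)
  end.

Definition subgroup (G : set ec_point) : Prop :=
  [/\ G zerop, (forall P Q, G P -> G Q -> G (addp P Q))
    & (forall P, G P -> G (oppp P))].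

Definition lin_indep (n : nat) (P : 'I_n -> ec_point) : Prop :=
  forall m : 'I_n -> int,
    \big[addp/zerop]_(i < n) mulzp (m i) (P i) = zerop -> forall i, m i = 0.

Definition has_rank (G : set ec_point) (n : nat) : Prop :=
  (exists2 P : 'I_n -> ec_point, (forall i, G (P i)) & lin_indep P) /\
  (forall P : 'I_n.+1 -> ec_point, (forall i, G (P i)) -> ~ lin_indep P).

End Points.

Section Reduction.
Variables (F : fieldType) (E : weierstrass).

(* For F = 'F_p: a point whose abscissa has denominator divisible by p reduces
   to the point at infinity; otherwise both coordinates are p-integral and
   [ratr] reduces them as numerator / denominator computed in F. *)
Definition reduce_raw (P : option (rat * rat)) : option (F * F) :=
  if P is Some (x, y) then
    if (denq x)%:~R == 0 :> F then None else Some (ratr x, ratr y)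
  else None.

Lemma reduce_on_curve P : on_curve E P -> on_curve E (reduce_raw P).
Proof.
case: P => [[x y]|//] /= /eqP h; case: ifPn => //= v0.
set u := numq x; set v := denq x; set m := numq y; set n := denq y.
have v0Q : (v%:~R : rat) != 0 by rewrite intr_eq0 denq_neq0.
have n0Q : (n%:~R : rat) != 0 by rewrite intr_eq0 denq_neq0.
have hZ : m ^+ 2 * v ^+ 3 + a1 E * u * v ^+ 2 * m * n + a3 E * m * n * v ^+ 3
        = n ^+ 2 * (u ^+ 3 + a2 E * u ^+ 2 * v + a4 E * u * v ^+ 2 + a6 E * v ^+ 3).
  apply: (@intr_inj rat).
  move: h; rewrite -(divq_num_den x) -(divq_num_den y) -/u -/v -/m -/n => h.
  rewrite !(rmorphD, rmorphM, rmorphXn) /=.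
  transitivity ((v%:~R ^+ 3 * n%:~R ^+ 2) *
    ((m%:~R / n%:~R) ^+ 2 + (a1 E)%:~R * (u%:~R / v%:~R) * (m%:~R / n%:~R) +
       (a3 E)%:~R * (m%:~R / n%:~R)) : rat).
    by field; rewrite v0Q n0Q.
  by rewrite h; field.
have hF := congr1 (fun z : int => z%:~R : F) hZ.
rewrite /= !(rmorphD, rmorphM, rmorphXn) /= in hF.
have n0 : (n%:~R : F) != 0.
  apply/negP => /eqP n0; move: hF; rewrite n0 !(mulr0, mul0r, addr0, expr0n) /=.
  move/eqP; rewrite mulf_eq0 !expf_eq0 /= (negPf v0) orbF => /eqP m0.
  have /coprimezP[[c d] /= e] : coprimez m n by exact: coprime_num_den.
  have := congr1 (fun z : int => z%:~R : F) e.
  rewrite /= rmorphD !rmorphM /= m0 n0 !mulr0 addr0 => /eqP.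
  by rewrite eq_sym oner_eq0.
rewrite /ratr -/u -/v -/m -/n; apply/eqP.
have d0 : (v%:~R ^+ 3 * n%:~R ^+ 2 : F) != 0 by rewrite mulf_neq0 ?expf_neq0.
apply: (mulfI d0).
move: hF; set U := (u%:~R : F); set V := (v%:~R : F).
set M := (m%:~R : F); set N := (n%:~R : F) => hF.
transitivity (M ^+ 2 * V ^+ 3 + (a1 E)%:~R * U * V ^+ 2 * M * N
              + (a3 E)%:~R * M * N * V ^+ 3 : F).
  by field; rewrite v0 n0.
by rewrite hF; field.
Qed.

Definition reduce (P : ec_point rat E) : ec_point F E :=
  exist _ (reduce_raw (sval P)) (reduce_on_curve (svalP P)).

End Reduction.

Arguments reduce F {E} P.

Section Heights.
Variables (R : realType) (E : weierstrass).

(* log max(|a|, b) where x(P) = a / b in lowest terms with b > 0. *)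
Definition naive_height (P : ec_point rat E) : R :=
  if sval P is Some (x, _) then ln (Num.max `|numq x| (denq x))%:~R else 0.

(* Tate's limit, normalised (with the factor 1/2) by the degree 2 of the
   abscissa; [iter n] of the doubling map is multiplication by 2^n. *)
Definition canonical_height (P : ec_point rat E) : R :=
  lim ((fun n : nat =>
    naive_height (iter n (fun T => addp T T) P) / 4 ^+ n) @ \oo) / 2.

Definition pseudolin_dep (x : R) (G : set (ec_point rat E)) (Q : ec_point rat E) : Prop :=
  ~ G Q /\
  forall p : nat, prime p -> p%:R <= x -> ~~ (p%:Z %| disc E)%Z ->
    (reduce 'F_p @` G) (reduce 'F_p Q).

End Heights.

(* Main.v *)
(* The point is Q = m P, where no nonzero multiple of P lies in Gamma. Let P0 in
   Gamma have infinite order. If P0 has order at least K modulo p, the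
   pigeonhole principle for the points i P0 + j P of E(F_p), which has at most
   2 p + 1 points, yields some n <= (2 p + 1) / K with n P in Gamma modulo p;
   and the order of P0 modulo p is at least K for all but finitely many p. With
   K proportional to D, it is thus enough that m be a suitable constant times a
   common multiple of the integers up to x / D, and there is such a multiple
   below 4 ^ (x / D). The height of m P is polynomial in m, so choosing D large
   enough gives the bound, with C = 0 and a better exponent if desired.

   The group law comes from the map sending P to the class of its maximal ideal
   in the coordinate ring: lines show that the ideal of P + Q is equivalent to
   the product of those of P and Q, and the map is injective because no element
   of the coordinate ring has a norm of degree 1. *)
Require Import Defs.
From HB Require Import structures.
From mathcomp Require Import all_boot all_order all_algebra.
From mathcomp Require Import ring lra zify.
From mathcomp Require Import all_classical all_reals all_analysis.

Set Implicit Arguments.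
Unset Strict Implicit.
Unset Printing Implicit Defensive.

Import Order.TTheory GRing.Theory Num.Theory.
Import numFieldNormedType.Exports.

Local Open Scope classical_set_scope.
Local Open Scope ring_scope.

(** * Ideals and the coordinate ring *)

Section Ideals.
Variable A : comNzRingType.
Implicit Types (I J K : set A) (a b c : A).

(** A factor D as large as desired can be gained because Gamma has positive rank: each of the
    finitely many points i P0, 0 < i < K, is nonzero and reduces to infinity only modulo primes
    dividing the denominator of its abscissa. The primes so excluded depend on D but not on x, and
    cost a constant factor in m. The exponent B in the height of m P is independent of P and m, so D
    may be chosen after B; this is why crude bounds suffice everywhere: two ordinates per abscissa,
    some polynomial growth of the logarithmic height, central binomial coefficients for the common
    multiple.

    The obstacle is that addition is given by formulas with cases, whereas the argument needs an
    abelian group over Q and over each F_p, with a morphism between them. One statement on three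
    collinear points, counted with multiplicity, covers chords and tangents alike, and in the
    residue field also chords that degenerate into tangents. *)

Definition is_ideal I : Prop :=
  [/\ I 0, forall a b, I a -> I b -> I (a + b) & forall a b, I b -> I (a * b)].

(* The additive span of the products, defined impredicatively. *)
Definition ideal_mul I J : set A := [set a | forall K : set A,
  K 0 -> (forall b c, K b -> K c -> K (b + c)) ->
  (forall b c, I b -> J c -> K (b * c)) -> K a].

Definition ideal_scale a I : set A := [set a * b | b in I].

Lemma ideal_mul_gen I J a b : I a -> J b -> ideal_mul I J (a * b).
Proof. by move=> Ia Jb K _ _; apply. Qed.

Lemma ideal_mul_min I J K : is_ideal K ->
  (forall a b, I a -> J b -> K (a * b)) -> ideal_mul I J `<=` K.
Proof. by case=> K0 KD _ IJK a; apply. Qed.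

Lemma is_ideal_mul I J : is_ideal I -> is_ideal (ideal_mul I J).
Proof.
case=> [I0 ID IM]; split.
- by move=> K.
- by move=> a b IJa IJb K K0 KD KM; exact: KD (IJa K K0 KD KM) (IJb K K0 KD KM).
- move=> a b /(_ [set t | ideal_mul I J (a * t)]); apply=> /=.
  + by rewrite mulr0 => K.
  + move=> c d IJc IJd; rewrite mulrDr => K K0 KD KM.
    exact: KD (IJc K K0 KD KM) (IJd K K0 KD KM).
  + by move=> c d Ic Jd; rewrite mulrA; apply: ideal_mul_gen => //; apply: IM.
Qed.

Lemma is_idealT : is_ideal setT. Proof. by split. Qed.

Lemma is_ideal_scale a I : is_ideal I -> is_ideal (ideal_scale a I).
Proof.
case=> [I0 ID IM]; split.
- by exists 0; rewrite ?mulr0.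
- by move=> _ _ [b Ib <-] [c Ic <-]; exists (b + c); [apply: ID | rewrite mulrDr].
- by move=> b _ [c Ic <-]; exists (b * c); [apply: IM | rewrite mulrCA].
Qed.

Lemma ideal_mulC I J : ideal_mul I J = ideal_mul J I.
Proof.
by apply/seteqP; split=> a IJa K K0 KD KM; apply: (IJa K) => // b c ? ?;
  rewrite mulrC; apply: KM.
Qed.

Lemma ideal_mulA I J K : is_ideal I -> is_ideal K ->
  ideal_mul I (ideal_mul J K) = ideal_mul (ideal_mul I J) K.
Proof.
move=> hI hK; apply/seteqP; split; apply: ideal_mul_min.
- by apply/is_ideal_mul/is_ideal_mul.
- move=> a t Ia /(_ [set u | ideal_mul (ideal_mul I J) K (a * u)]); apply=> /=.
  + by rewrite mulr0; have [] := is_ideal_mul K (is_ideal_mul J hI).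
  + move=> b c hb hc; rewrite mulrDr.
    by have [_ hD _] := is_ideal_mul K (is_ideal_mul J hI); apply: hD.
  + by move=> b c Jb Kc; rewrite mulrA; do 2 ?apply: ideal_mul_gen.
- exact: is_ideal_mul.
- move=> t c IJt Kc; move: t IJt; apply: ideal_mul_min; last first.
    by move=> a b Ia Jb; rewrite -mulrA; do 2 ?apply: ideal_mul_gen.
  have [h0 hD hM] := is_ideal_mul (ideal_mul J K) hI.
  split; first by rewrite /= mul0r.
    by move=> a b ha hb; rewrite /= mulrDl; apply: hD.
  by move=> a b hb; rewrite /= -mulrA; apply: hM.
Qed.

Lemma ideal_mul1 I : is_ideal I -> ideal_mul setT I = I.
Proof.
move=> hI; apply/seteqP; split; last first.
  by move=> a Ia; rewrite -(mul1r a); apply: ideal_mul_gen.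
by apply: ideal_mul_min => // a b _; case: hI => _ _; apply.
Qed.

Lemma ideal_scaleA a b I :
  ideal_scale a (ideal_scale b I) = ideal_scale (a * b) I.
Proof.
apply/seteqP; split.
  by move=> _ [_ [c Ic <-] <-]; exists c => //; rewrite mulrA.
by move=> _ [c Ic <-]; exists (b * c); [exists c | rewrite mulrA].
Qed.

Lemma ideal_scale_mul a I J : is_ideal I ->
  ideal_mul (ideal_scale a I) J = ideal_scale a (ideal_mul I J).
Proof.
move=> hI; apply/seteqP; split.
  apply: ideal_mul_min; first exact/is_ideal_scale/is_ideal_mul.
  move=> _ c [b Ib <-] Jc; exists (b * c); first exact: ideal_mul_gen.
  by rewrite mulrA.
move=> _ [t IJt <-]; move: t IJt; apply: ideal_mul_min; last first.
  by move=> b c Ib Jc; rewrite mulrA; apply: ideal_mul_gen => //; exists b.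
have [h0 hD hM] := is_ideal_mul J (is_ideal_scale a hI).
split; first by rewrite /= mulr0.
  by move=> b c hb hc; rewrite /= mulrDr; apply: hD.
by move=> b c hc; rewrite /= mulrCA; apply: hM.
Qed.

Lemma ideal_scale_inj a I J : (forall b c, a * b = a * c -> b = c) ->
  ideal_scale a I = ideal_scale a J -> I = J.
Proof.
move=> ainj /seteqP[sIJ sJI]; apply/seteqP; split=> b.
  by move=> Ib; have [|c Jc /ainj <-] := sIJ (a * b); first by exists b.
by move=> Jb; have [|c Ic /ainj <-] := sJI (a * b); first by exists b.
Qed.

End Ideals.

Section CoordinateRing.
Variables (F : fieldType) (E : weierstrass).
Local Notation A1 := ((a1 E)%:~R : F).
Local Notation A2 := ((a2 E)%:~R : F).
Local Notation A3 := ((a3 E)%:~R : F).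
Local Notation A4 := ((a4 E)%:~R : F).
Local Notation A6 := ((a6 E)%:~R : F).

Definition ylin : {poly F} := A1%:P * 'X + A3%:P.
Definition xcubic : {poly F} := 'X ^+ 3 + A2%:P * 'X ^+ 2 + A4%:P * 'X + A6%:P.

End CoordinateRing.

(* [(p, q)] stands for [p + q * Y], where [Y ^+ 2 = xcubic - ylin * Y]. *)
Definition coord_ring (F : fieldType) (E : weierstrass) : Type :=
  ({poly F} * {poly F})%type.

HB.instance Definition _ F E :=
  GRing.Zmodule.copy (coord_ring F E) ({poly F} * {poly F})%type.

Section CoordinateRingTheory.
Variables (F : fieldType) (E : weierstrass).
Local Notation A1 := ((a1 E)%:~R : F).
Local Notation A2 := ((a2 E)%:~R : F).
Local Notation A3 := ((a3 E)%:~R : F).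
Local Notation A4 := ((a4 E)%:~R : F).
Local Notation A6 := ((a6 E)%:~R : F).
Local Notation A := (coord_ring F E).
Local Notation h := (ylin F E).
Local Notation f := (xcubic F E).
Implicit Types a b c : A.

Definition coord_one : A := (1, 0).
Definition coord_mul (a b : A) : A :=
  (a.1 * b.1 + a.2 * b.2 * f, a.1 * b.2 + a.2 * b.1 - a.2 * b.2 * h).

Fact coord_mulA : associative coord_mul.
Proof. by move=> [a b] [c d] [e g]; congr pair; rewrite /=; ring. Qed.
Fact coord_mulC : commutative coord_mul.
Proof. by move=> [a b] [c d]; congr pair; rewrite /=; ring. Qed.
Fact coord_mul1 : left_id coord_one coord_mul.
Proof. by move=> [a b]; congr pair; rewrite /=; ring. Qed.
Fact coord_mulDl : left_distributive coord_mul +%R.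
Proof. by move=> [a b] [c d] [e g]; congr pair; rewrite /=; ring. Qed.
Fact coord_one_neq0 : coord_one != 0.
Proof. by rewrite xpair_eqE oner_eq0. Qed.

HB.instance Definition _ := GRing.Zmodule_isComNzRing.Build A
  coord_mulA coord_mulC coord_mul1 coord_mulDl coord_one_neq0.

Lemma coordM a b : a * b =
  (a.1 * b.1 + a.2 * b.2 * f, a.1 * b.2 + a.2 * b.1 - a.2 * b.2 * h).
Proof. by []. Qed.

Definition coord_poly (p : {poly F}) : A := (p, 0).

Fact coord_poly_zmod : zmod_morphism coord_poly.
Proof. by move=> p q; congr pair; rewrite subr0. Qed.
Fact coord_poly_monoid : monoid_morphism coord_poly.
Proof. by split=> // p q; rewrite coordM; congr pair; rewrite /=; ring. Qed.
HB.instance Definition _ :=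
  GRing.isZmodMorphism.Build {poly F} A coord_poly coord_poly_zmod.
HB.instance Definition _ :=
  GRing.isMonoidMorphism.Build {poly F} A coord_poly coord_poly_monoid.

Definition coordY : A := (0, 1).

Lemma coordE a : a = coord_poly a.1 + coord_poly a.2 * coordY.
Proof. by case: a => p q; rewrite coordM; congr pair; rewrite /=; ring. Qed.

Lemma coordYY : coordY ^+ 2 = coord_poly f - coord_poly h * coordY.
Proof. by rewrite expr2 !coordM; congr pair; rewrite /=; ring. Qed.

(** The product of [a] and its conjugate under Y -> - Y - [ylin]. *)
Definition coord_norm a : {poly F} := a.1 ^+ 2 - a.1 * a.2 * h - a.2 ^+ 2 * f.

Lemma coord_normM a b : coord_norm (a * b) = coord_norm a * coord_norm b.
Proof. by case: a b => [a b] [c d]; rewrite /coord_norm /=; ring. Qed.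

Lemma coord_norm_poly p : coord_norm (coord_poly p) = p ^+ 2.
Proof. by rewrite /coord_norm /=; ring. Qed.

Lemma size_ylin : (size h <= 2)%N.
Proof.
rewrite /ylin (leq_trans (size_polyD _ _)) // geq_max mul_polyC.
rewrite (leq_trans (size_scale_leq _ _)) ?size_polyX //.
by rewrite (leq_trans (size_polyC_leq1 _)).
Qed.

Lemma size_xcubic : size f = 4%N.
Proof.
rewrite /xcubic -!addrA size_polyDl size_polyXn //.
rewrite (leq_ltn_trans (size_polyD _ _)) // gtn_max !mul_polyC.
rewrite (leq_ltn_trans (size_scale_leq _ _)) ?size_polyXn //=.
rewrite (leq_ltn_trans (size_polyD _ _)) // gtn_max.
rewrite (leq_ltn_trans (size_scale_leq _ _)) ?size_polyX //=.
by rewrite (leq_ltn_trans (size_polyC_leq1 _)).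
Qed.

(* The two squares have sizes of different parity, so their leading terms
   cannot cancel; in particular the norm never has degree 1. *)
Lemma size_coord_norm a : a.2 != 0 ->
  size (coord_norm a) = maxn (size a.1).*2.-1 (size a.2).*2.+2.
Proof.
case: a => p q /= q0; rewrite /coord_norm /=.
have sq : size (q ^+ 2 * f) = (size q).*2.+2.
  have f0 : f != 0 by rewrite -size_poly_eq0 size_xcubic.
  have sq2 : size (q ^+ 2) = (size q).*2.-1 by rewrite expr2 size_mul // addnn.
  rewrite size_mul ?expf_neq0 // size_xcubic sq2.
  by have : (0 < size q)%N; [rewrite size_poly_gt0 | lia].
have [->|p0] := eqVneq p 0.
  rewrite expr0n !mul0r subr0 add0r size_polyN sq size_poly0.
  by rewrite max0n.
have sp : size (p ^+ 2) = (size p).*2.-1.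
  by rewrite expr2 size_mul // addnn.
have sx : (size (p * q * h)%R <= size p + size q)%N.
  apply: (leq_trans (size_polyMleq _ _)).
  have -> : size (p * q) = (size p + size q).-1 by rewrite size_mul.
  move: size_ylin.
  have : (0 < size p)%N by rewrite size_poly_gt0.
  have : (0 < size q)%N by rewrite size_poly_gt0.
  lia.
have sp0 : (0 < size p)%N by rewrite size_poly_gt0.
have [lt_pq|lt_qp] := ltnP (size p).*2.-1 (size q).*2.+2.
  rewrite addrC size_polyDl size_polyN sq //.
  rewrite (leq_ltn_trans (size_polyD _ _)) // gtn_max size_polyN sp lt_pq /=.
  by apply: (leq_ltn_trans sx); move: (size p) (size q) lt_pq => m n; lia.
rewrite -addrA size_polyDl sp //.
rewrite (leq_ltn_trans (size_polyD _ _)) // gtn_max !size_polyN sq.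
move: (size _) (size p) (size q) sx lt_qp sp0 => k m n; lia.
Qed.

Lemma coord_norm_eq0 a : (coord_norm a == 0) = (a == 0).
Proof.
apply/eqP/eqP => [|->]; last by rewrite /coord_norm /=; ring.
have [a20|a2n0] := eqVneq a.2 0; last first.
  by move/(congr1 (size : {poly F} -> nat)); rewrite size_coord_norm // size_poly0; lia.
rewrite /coord_norm a20 => /eqP.
rewrite expr0n mulr0 !mul0r !subr0 expf_eq0 /= => /eqP a10.
by case: a a10 a20 => p q /= -> ->.
Qed.

Lemma coord_mulf_eq0 a b : (a * b == 0) = (a == 0) || (b == 0).
Proof. by rewrite -!coord_norm_eq0 coord_normM mulf_eq0. Qed.

Lemma coord_mulfI a : a != 0 -> forall b c, a * b = a * c -> b = c.
Proof.
move=> a0 b c /eqP; rewrite -subr_eq0 -mulrBr coord_mulf_eq0 (negPf a0) /=.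
by rewrite subr_eq0 => /eqP.
Qed.

End CoordinateRingTheory.

(** * Ideals of points *)

Section PolyIdeals.
Variables (F : fieldType) (C : set {poly F}).
Hypothesis hC : is_ideal C.

Lemma poly_idealZ (c : F) (p : {poly F}) : c != 0 -> C (c%:P * p) -> C p.
Proof.
case: hC => _ _ CM c0 /(CM (c^-1)%:P).
by rewrite mulrA -polyCM mulVf // mul1r.
Qed.

(** Meant for a line that meets the curve twice at abscissa t. Modulo X - t, [M] is the nonzero
    constant [M.[t]]: the first two members yield X - t, and the third then yields a unit. *)
Lemma poly_ideal_double (t : F) (M : {poly F}) : M.[t] != 0 ->
  C (('X - t%:P) ^+ 2) -> C (M * ('X - t%:P)) -> C (M ^+ 2) -> C 1.
Proof.
have [_ CD CM] := hC; move=> Mt Ct CMt CM2.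
have /factor_theorem[q hq] : root (M - M.[t]%:P) t.
  by rewrite /root !hornerE subrr.
have CX : C ('X - t%:P).
  apply: (poly_idealZ Mt); have := CD _ _ CMt (CM (- q) _ Ct).
  congr C; transitivity ((M - q * ('X - t%:P)) * ('X - t%:P)); first by ring.
  by rewrite -hq; ring.
apply: (poly_idealZ Mt); apply: (poly_idealZ Mt).
have := CD _ _ CM2 (CM (- (M + M.[t]%:P) * q) _ CX); congr C.
by rewrite -mulrA -hq; ring.
Qed.

(** The difference of two of the products is a nonzero constant times their common factor, and the
    difference of two such factors is a nonzero constant. *)
Lemma poly_ideal_distinct (x1 x2 x3 : F) : x1 != x2 -> x1 != x3 -> x2 != x3 ->
  C (('X - x1%:P) * ('X - x2%:P)) -> C (('X - x1%:P) * ('X - x3%:P)) ->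
  C (('X - x2%:P) * ('X - x3%:P)) -> C 1.
Proof.
have [_ CD CM] := hC; move=> n12 n13 n23 C12 C13 C23.
have CX1 : C ('X - x1%:P).
  apply: (@poly_idealZ (x3 - x2)); first by rewrite subr_eq0 eq_sym.
  have := CD _ _ C12 (CM (-1) _ C13); congr C; ring.
have CX2 : C ('X - x2%:P).
  apply: (@poly_idealZ (x3 - x1)); first by rewrite subr_eq0 eq_sym.
  have := CD _ _ C12 (CM (-1) _ C23); congr C; ring.
apply: (@poly_idealZ (x2 - x1)); first by rewrite subr_eq0 eq_sym.
have := CD _ _ CX1 (CM (-1) _ CX2); congr C; ring.
Qed.

End PolyIdeals.

Section PointIdeals.
Variables (F : fieldType) (E : weierstrass).
Local Notation A1 := ((a1 E)%:~R : F).
Local Notation A2 := ((a2 E)%:~R : F).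
Local Notation A3 := ((a3 E)%:~R : F).
Local Notation A4 := ((a4 E)%:~R : F).
Local Notation A6 := ((a6 E)%:~R : F).
Local Notation A := (coord_ring F E).
Local Notation h := (ylin F E).
Local Notation f := (xcubic F E).
Local Notation iota := (@coord_poly F E).
Local Notation Y := (@coordY F E).
Implicit Types (a b c : A) (P Q S T : ec_point F E).

Lemma on_curveP x y : reflect
  (y ^+ 2 + A1 * x * y + A3 * y = x ^+ 3 + A2 * x ^+ 2 + A4 * x + A6)
  (on_curve (F := F) E (Some (x, y))).
Proof. exact: eqP. Qed.

Lemma ec_point_inj P Q : sval P = sval Q -> P = Q.
Proof. exact: val_inj. Qed.

(* [y = lam * x + nu] meets the curve in the points of abscissae x1, x2, x3:
   the coefficients of the cubic in x are compared. *)
Definition collinear (lam nu x1 x2 x3 : F) : Prop :=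
  [/\ A2 = lam ^+ 2 + A1 * lam - x1 - x2 - x3,
      A4 = 2 * lam * nu + A1 * nu + A3 * lam + x1 * x2 + x1 * x3 + x2 * x3
    & A6 = nu ^+ 2 + A3 * nu - x1 * x2 * x3].

Lemma collinear_rot lam nu x1 x2 x3 :
  collinear lam nu x1 x2 x3 -> collinear lam nu x2 x3 x1.
Proof. by rewrite /collinear => -[-> -> ->]; split; ring. Qed.

Lemma collinear_on_curve lam nu x1 x2 x3 :
  collinear lam nu x1 x2 x3 -> on_curve (F := F) E (Some (x1, lam * x1 + nu)).
Proof. by case=> e2 e4 e6; apply/on_curveP; rewrite e2 e4 e6; ring. Qed.

(** Chords and tangents are merged here into one set of equations, so that later arguments do not
    distinguish x1 = x2 from x1 != x2. *)
Lemma addp_collinear P Q x1 y1 x2 y2 :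
  sval P = Some (x1, y1) -> sval Q = Some (x2, y2) ->
  (x1 == x2) && (y1 + y2 + A1 * x2 + A3 == 0) = false ->
  exists lam nu x3, [/\ collinear lam nu x1 x2 x3,
    y1 = lam * x1 + nu, y2 = lam * x2 + nu
    & sval (addp P Q) = opp_raw E (Some (x3, lam * x3 + nu))].
Proof.
move=> eP eQ hN.
have /on_curveP hP : on_curve E (Some (x1, y1)) by rewrite -eP (svalP P).
have /on_curveP hQ : on_curve E (Some (x2, y2)) by rewrite -eQ (svalP Q).
pose lam := if x1 == x2
      then (3 * x1 ^+ 2 + 2 * A2 * x1 + A4 - A1 * y1) / (2 * y1 + A1 * x1 + A3)
      else (y2 - y1) / (x2 - x1).
pose nu := y1 - lam * x1.
pose x3 := lam ^+ 2 + A1 * lam - A2 - x1 - x2.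
exists lam, nu, x3.
have e1 : y1 = lam * x1 + nu by rewrite /nu; ring.
have eA2 : A2 = lam ^+ 2 + A1 * lam - x1 - x2 - x3 by rewrite /x3; ring.
have eS : sval (addp P Q) = opp_raw E (Some (x3, lam * x3 + nu)).
  rewrite /addp /= eP eQ /= hN -/lam -/nu -/x3; congr (Some (_, _)); ring.
have [e12|n12] := eqVneq x1 x2.
  have e12y : y1 = y2.
    subst x2; have /eqP : (y1 - y2) * (y1 + y2 + A1 * x1 + A3) = 0.
      transitivity ((y1 ^+ 2 + A1 * x1 * y1 + A3 * y1)
                    - (y2 ^+ 2 + A1 * x1 * y2 + A3 * y2)); first by ring.
      by rewrite hP hQ subrr.
    rewrite mulf_eq0 subr_eq0 => /orP[/eqP //|h0].
    by rewrite eqxx h0 in hN.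
  subst x2 y2; rewrite eqxx /= in hN.
  have dn0 : 2 * y1 + A1 * x1 + A3 != 0.
    by apply/negP => /eqP h0; move/eqP: hN; apply; rewrite -h0; ring.
  have hl : A4 = lam * (2 * y1 + A1 * x1 + A3)
                 - 3 * x1 ^+ 2 - 2 * A2 * x1 + A1 * y1.
    by rewrite {1}/lam eqxx divfK //; ring.
  have eA4 : A4 = 2 * lam * nu + A1 * nu + A3 * lam + x1 * x1 + x1 * x3 + x1 * x3.
    by rewrite hl e1 eA2; ring.
  split=> //; split=> //.
  have -> : A6 = y1 ^+ 2 + A1 * x1 * y1 + A3 * y1 - x1 ^+ 3 - A2 * x1 ^+ 2 - A4 * x1.
    by rewrite hP; ring.
  by rewrite eA4 e1 eA2; ring.
have d0 : x2 - x1 != 0 by rewrite subr_eq0 eq_sym.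
have hl : lam * (x2 - x1) = y2 - y1 by rewrite /lam (negPf n12) divfK.
have e2 : y2 = lam * x2 + nu.
  by rewrite -[y2](subrK y1) -hl e1; ring.
have eA4 : A4 = 2 * lam * nu + A1 * nu + A3 * lam + x1 * x2 + x1 * x3 + x2 * x3.
  (* Multiplied by x2 - x1, the equation for A4 is the difference of the curve equations at the two
     points. *)
  apply: (mulfI d0); transitivity (y2 ^+ 2 + A1 * x2 * y2 + A3 * y2
    - (y1 ^+ 2 + A1 * x1 * y1 + A3 * y1) - x2 ^+ 3 + x1 ^+ 3
    - A2 * (x2 ^+ 2 - x1 ^+ 2)); first by rewrite hP hQ; ring.
  by rewrite e1 e2 eA2; ring.
split=> //; split=> //.
have -> : A6 = y1 ^+ 2 + A1 * x1 * y1 + A3 * y1 - x1 ^+ 3 - A2 * x1 ^+ 2 - A4 * x1.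
  by rewrite hP; ring.
by rewrite eA4 e1 eA2; ring.
Qed.

Definition coord_eval (x y : F) a : F := a.1.[x] + a.2.[x] * y.

(** The point at infinity lies outside the affine curve, whence the unit ideal, which is neutral for
    the product. *)
Definition pt_ideal P : set A :=
  if sval P is Some (x, y) then [set a | coord_eval x y a = 0] else setT.

Lemma coord_evalM x y a b : on_curve E (Some (x, y)) ->
  coord_eval x y (a * b) = coord_eval x y a * coord_eval x y b.
Proof.
move=> /on_curveP hxy; rewrite /coord_eval coordM /= /xcubic /ylin.
rewrite !(hornerD, hornerN, hornerM, horner_exp, hornerC, hornerX).
have -> : A6 = y ^+ 2 + A1 * x * y + A3 * y - x ^+ 3 - A2 * x ^+ 2 - A4 * x.
  by rewrite hxy; ring.
ring.
Qed.

Lemma coord_evalD x y a b :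
  coord_eval x y (a + b) = coord_eval x y a + coord_eval x y b.
Proof.
have -> : a + b = (a.1 + b.1, a.2 + b.2) by [].
by rewrite /coord_eval !hornerD; ring.
Qed.

Lemma is_ideal_pt P : is_ideal (pt_ideal P).
Proof.
case: P => [[[x y]|] hP]; last exact: is_idealT.
split=> [|a b ha hb|a b hb]; rewrite /pt_ideal /=.
- by rewrite /coord_eval !hornerE.
- by rewrite coord_evalD ha hb addr0.
- by rewrite coord_evalM // hb mulr0.
Qed.

Lemma pt_ideal_gen x y a : coord_eval x y a = 0 -> exists u v : A,
  a = u * iota ('X - x%:P) + v * (Y - iota y%:P).
Proof.
case: a => p q; rewrite /coord_eval /= => e0.
have /factor_theorem[u hu] : root (p - p.[x]%:P) x.
  by rewrite /root !hornerE subrr.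
have /factor_theorem[v hv] : root (q - q.[x]%:P) x.
  by rewrite /root !hornerE subrr.
exists (iota u + iota v * Y), (iota q.[x]%:P).
have -> : (p, q) = iota p + iota q * Y := coordE (p, q).
have -> : p = u * ('X - x%:P) + p.[x]%:P by rewrite -hu subrK.
have {1}-> : q = v * ('X - x%:P) + q.[x]%:P by rewrite -hv subrK.
have -> : p.[x] = - (q.[x] * y) by apply/eqP; rewrite -subr_eq0 opprK e0.
ring.
Qed.

Lemma pt_ideal_subE P x y a : sval P = Some (x, y) ->
  pt_ideal P a -> exists u v : A,
  a = u * iota ('X - x%:P) + v * (Y - iota y%:P).
Proof. by rewrite /pt_ideal => -> /pt_ideal_gen. Qed.

Lemma pt_ideal_X P x y : sval P = Some (x, y) -> pt_ideal P (iota ('X - x%:P)).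
Proof.
rewrite /pt_ideal => -> /=.
by rewrite /coord_eval /= !hornerE subrr.
Qed.

Lemma pt_ideal_line P x (l : {poly F}) :
  sval P = Some (x, l.[x]) -> pt_ideal P (Y - iota l).
Proof.
rewrite /pt_ideal => -> /=.
have -> : Y - iota l = (- l, 1) :> A by congr pair; rewrite /=; ring.
by rewrite /coord_eval /= !hornerE addNr.
Qed.

Lemma coord_poly_neq0 (p : {poly F}) : p != 0 -> iota p != 0.
Proof. by apply: contraNN => /eqP[->]. Qed.

Lemma coord_line_neq0 (l : {poly F}) : Y - iota l != 0.
Proof.
apply/eqP => -[_] /eqP; apply/negP.
by rewrite subr0 oner_eq0.
Qed.

(** The two expressions are, up to sign, the partial derivatives of the Weierstrass equation. *)
Hypothesis smooth : forall x y : F, on_curve E (Some (x, y)) ->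
  2 * y + A1 * x + A3 = 0 -> 3 * x ^+ 2 + 2 * A2 * x + A4 - A1 * y = 0 -> False.

(** The vertical line through P meets the curve in P and - P. Smoothness is what puts X - x itself
    into the product when these two points coincide. *)
Lemma pt_ideal_opp P x y : sval P = Some (x, y) ->
  ideal_mul (pt_ideal P) (pt_ideal (oppp P)) = ideal_scale (iota ('X - x%:P)) setT.
Proof.
move=> eP; pose y' := - y - A1 * x - A3.
have eP' : sval (oppp P) = Some (x, y') by rewrite /= eP.
have hP : on_curve E (Some (x, y)) by rewrite -eP (svalP P).
(* The quotient of [xcubic] minus its value at x by X - x. *)
pose g : {poly F} := 'X ^+ 2 + x%:P * 'X + (x ^+ 2)%:P
  + A2%:P * ('X + x%:P) + A4%:P.
have eYY : (Y - iota y%:P) * (Y - iota y'%:P)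
    = iota ('X - x%:P) * (iota g - iota A1%:P * Y).
  have -> : (Y - iota y%:P) * (Y - iota y'%:P) = Y ^+ 2 - iota (y + y')%:P * Y + iota (y * y')%:P.
    by rewrite !(polyCD, polyCM); ring.
  rewrite coordYY /xcubic /ylin.
  have -> : A6 = - y * y' - x ^+ 3 - A2 * x ^+ 2 - A4 * x.
    by move/on_curveP: hP => hP; apply/eqP; rewrite -subr_eq0; apply/eqP;
      rewrite /y'; move/eqP: hP; rewrite -subr_eq0 => /eqP hP; rewrite -[RHS]oppr0 -hP; ring.
  by rewrite /g /y' !(polyCD, polyCM, polyCN, polyC_exp); ring.
have hI := is_ideal_mul (pt_ideal (oppp P)) (is_ideal_pt P).
apply/seteqP; split.
  apply: ideal_mul_min; first exact/is_ideal_scale/is_idealT.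
  move=> a b /(pt_ideal_subE eP)[u [v ->]] /(pt_ideal_subE eP')[w [z ->]].
  exists (u * w * iota ('X - x%:P) + u * z * (Y - iota y'%:P)
    + v * w * (Y - iota y%:P) + v * z * (iota g - iota A1%:P * Y)) => //.
  transitivity (u * w * iota ('X - x%:P) ^+ 2
    + u * z * iota ('X - x%:P) * (Y - iota y'%:P)
    + v * w * iota ('X - x%:P) * (Y - iota y%:P)
    + v * z * (iota ('X - x%:P) * (iota g - iota A1%:P * Y))).
    by move: (iota _ - _ * Y) => k; ring.
  by rewrite -eYY; ring.
move=> _ [b _ <-]; rewrite mulrC; case: (hI) => _ hD hM; apply: (hM).
have hX := pt_ideal_X eP; have hX' := pt_ideal_X eP'.
have hY : pt_ideal P (Y - iota y%:P) by apply: (@pt_ideal_line _ x); rewrite hornerC.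
have hY' : pt_ideal (oppp P) (Y - iota y'%:P).
  by apply: (@pt_ideal_line _ x); rewrite hornerC.
have hXX := ideal_mul_gen hX hX'; have hXY := ideal_mul_gen hX hY'.
have hYX := ideal_mul_gen hY hX'; have hYY := ideal_mul_gen hY hY'.
pose d := 2 * y + A1 * x + A3.
(* Since [d] is y - y', the generators (X - x)(Y - y') and (X - x)(Y - y) differ by d (X - x). *)
have [d0|dn0] := eqVneq d 0; last first.
  have := hD _ _ hXY (hM (-1) _ hYX) => /(hM (iota (d^-1)%:P)).
  congr (ideal_mul _ _ _).
  transitivity (iota ((d^-1 * d)%:P) * iota ('X - x%:P)); last by rewrite mulVf // rmorph1 mul1r.
  by rewrite /d /y' !(polyCD, polyCM, polyCN); ring.
(* Now P = - P, and [e] is the value at P of the cofactor g - A1 Y in [eYY]; it is nonzero by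
   smoothness. *)
pose e := 3 * x ^+ 2 + 2 * A2 * x + A4 - A1 * y.
have en0 : e != 0 by apply/eqP; apply: (smooth hP d0).
rewrite eYY in hYY.
have [q hq] : exists q : A, iota g - iota A1%:P * Y
    = iota e%:P + q * iota ('X - x%:P) - iota A1%:P * (Y - iota y%:P).
  exists (iota ('X + 2%:P * x%:P + A2%:P)).
  by rewrite /g /e !(polyCD, polyCM, polyCN, polyC_exp); ring.
have := hD _ _ (hD _ _ hYY (hM (- q) _ hXX)) (hM (iota A1%:P) _ hYX).
move=> /(hM (iota (e^-1)%:P)); congr (ideal_mul _ _ _).
transitivity (iota ((e^-1 * e)%:P) * iota ('X - x%:P)); last by rewrite mulVf // rmorph1 mul1r.
by rewrite hq polyCM; ring.
Qed.

(** Each of the three ideals is generated by X - xi and the line L. With L' the conjugate of L up to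
    sign, L L' is the product of the X - xi. *)
Lemma pt_ideal_collinear P Q S lam nu x1 x2 x3 : collinear lam nu x1 x2 x3 ->
  sval P = Some (x1, lam * x1 + nu) -> sval Q = Some (x2, lam * x2 + nu) ->
  sval S = Some (x3, lam * x3 + nu) ->
  ideal_mul (ideal_mul (pt_ideal P) (pt_ideal Q)) (pt_ideal S)
  = ideal_scale (Y - iota (lam%:P * 'X + nu%:P)) setT.
Proof.
move=> hcol eP eQ eS; set l := lam%:P * 'X + nu%:P.
have hl x : l.[x] = lam * x + nu by rewrite /l !hornerE.
pose L := Y - iota l; pose L' := Y + iota l + iota h.
have eLL : L * L' = iota ('X - x1%:P) * iota ('X - x2%:P) * iota ('X - x3%:P).
  have -> : L * L' = Y ^+ 2 + iota h * Y - iota (l ^+ 2 + h * l).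
    by rewrite /L /L'; ring.
  rewrite coordYY subrK; case: hcol => e2 e4 e6.
  rewrite -!rmorphM -rmorphB; congr iota.
  rewrite /xcubic /ylin e2 e4 e6 /l !(polyCD, polyCM, polyCN, polyC_exp).
  by ring.
pose M := l + l + h.
have eM : L' = L + iota M by rewrite /L /L' /M; ring.
have hIPQ := is_ideal_mul (pt_ideal Q) (is_ideal_pt P).
have hI := is_ideal_mul (pt_ideal S) hIPQ.
set I := ideal_mul _ (pt_ideal S) in hI *.
have gen T x u v : sval T = Some (x, l.[x]) ->
    pt_ideal T (u * iota ('X - x%:P) + v * L).
  move=> eT; case: (is_ideal_pt T) => _ hD hM; apply: hD; apply: hM.
    exact: pt_ideal_X eT.
  exact: pt_ideal_line eT.
have genE T x a : sval T = Some (x, l.[x]) -> pt_ideal T a ->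
    exists u v, a = u * iota ('X - x%:P) + v * L.
  move=> eT /(pt_ideal_subE eT)[u [v ->]].
  have /factor_theorem[q hq] : root (l - l.[x]%:P) x by rewrite /root !hornerE subrr.
  exists (u + v * iota q), v; rewrite /L.
  have -> : iota l = iota q * iota ('X - x%:P) + iota l.[x]%:P.
    by rewrite -rmorphM -hq -rmorphD subrK.
  ring.
rewrite -hl in eP; rewrite -hl in eQ; rewrite -hl in eS.
apply/seteqP; split.
  have hS := is_ideal_scale L (is_idealT A).
  apply: ideal_mul_min => // ab c hab hc; move: ab hab.
  have hK : is_ideal [set t | ideal_scale L setT (t * c)].
    case: hS => h0 hD hM; split; rewrite /=.
    - by rewrite mul0r.
    - by move=> a b ha hb; rewrite mulrDl; apply: hD.
    - by move=> a b hb; rewrite -mulrA; apply: hM.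
  apply: ideal_mul_min hK _ => a b ha hb; rewrite /=.
  have [u1 [v1 ->]] := genE _ _ _ eP ha.
  have [u2 [v2 ->]] := genE _ _ _ eQ hb.
  have [u3 [v3 ->]] := genE _ _ _ eS hc.
  set X1 := iota ('X - x1%:P) in eLL *; set X2 := iota ('X - x2%:P) in eLL *.
  set X3 := iota ('X - x3%:P) in eLL *.
  (* In the expanded product, only u1 u2 u3 X1 X2 X3 lacks a factor L, and it equals u1 u2 u3 L
     L'. *)
  exists (u1 * u2 * u3 * L' + v1 * u2 * u3 * X2 * X3 + u1 * v2 * u3 * X1 * X3
     + u1 * u2 * v3 * X1 * X2 + v1 * v2 * L * (u3 * X3 + v3 * L)
     + v1 * v3 * u2 * X2 * L + v2 * v3 * u1 * X1 * L) => //.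
  transitivity (u1 * u2 * u3 * (L * L') + L * (v1 * u2 * u3 * X2 * X3 + u1 * v2 * u3 * X1 * X3
     + u1 * u2 * v3 * X1 * X2 + v1 * v2 * L * (u3 * X3 + v3 * L)
     + v1 * v3 * u2 * X2 * L + v2 * v3 * u1 * X1 * L)); first by ring.
  by rewrite eLL; ring.
have [hI0 hID hIM] := hI.
(* The quotient of I by L. It must contain 1; its known elements come from the products of
   generators that are divisible by L. *)
pose C := [set t : A | I (L * t)].
have hC : is_ideal C.
  split; rewrite /C /=; first by rewrite mulr0.
    by move=> a b ha hb; rewrite mulrDr; apply: hID.
  by move=> a b hb; rewrite mulrCA; apply: hIM.
suff C1 : C 1.
  by move=> _ [t _ <-]; have := hIM t _ C1; congr I; rewrite -/L; ring.
have prod u1 v1 u2 v2 u3 v3 : I ((u1 * iota ('X - x1%:P) + v1 * L)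
    * (u2 * iota ('X - x2%:P) + v2 * L) * (u3 * iota ('X - x3%:P) + v3 * L)).
  apply: ideal_mul_gen; last exact: gen.
  by apply: ideal_mul_gen; apply: gen.
have CL' : C L' by rewrite /C /= eLL; have := prod 1 0 1 0 1 0; congr I; ring.
have C12 : C (iota (('X - x1%:P) * ('X - x2%:P))).
  by rewrite /C /=; have := prod 1 0 1 0 0 1; congr I; ring.
have C13 : C (iota (('X - x1%:P) * ('X - x3%:P))).
  by rewrite /C /=; have := prod 1 0 0 1 1 0; congr I; ring.
have C23 : C (iota (('X - x2%:P) * ('X - x3%:P))).
  by rewrite /C /=; have := prod 0 1 1 0 1 0; congr I; ring.
have CL1 : C (L * iota ('X - x1%:P)).
  by rewrite /C /=; have := prod 1 0 0 1 0 1; congr I; ring.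
have CL2 : C (L * iota ('X - x2%:P)).
  by rewrite /C /=; have := prod 0 1 1 0 0 1; congr I; ring.
have CL3 : C (L * iota ('X - x3%:P)).
  by rewrite /C /=; have := prod 0 1 0 1 1 0; congr I; ring.
have CLL : C (L * L).
  by rewrite /C /=; have := prod 0 1 0 1 0 1; congr I; ring.
have [_ CD CM] := hC.
pose D := [set p : {poly F} | C (iota p)].
have hD : is_ideal D.
  split; rewrite /D /=; first by rewrite rmorph0; case: hC.
    by move=> a b ha hb; rewrite rmorphD; apply: CD.
  by move=> a b hb; rewrite rmorphM; apply: CM.
(* Since L' = L + M lies in C, Y can be eliminated: modulo C, L may be replaced by - M. What remains
   is a question about polynomials in X. *)
have DM x : C (L * iota ('X - x%:P)) -> D (M * ('X - x%:P)).
  move=> CLx; rewrite /D /=.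
  have := CD _ _ (CM (iota ('X - x%:P)) _ CL') (CM (-1) _ CLx).
  by congr C; rewrite eM; ring.
have DMM : D (M ^+ 2).
  rewrite /D /=.
  have := CD _ _ (CM (iota M - L) _ CL') CLL.
  by congr C; rewrite eM; ring.
(* [M.[t]] is the derivative in y at the point of abscissa t. If it vanished, the double root would
   make the derivative in x vanish too. *)
have dbl t x : collinear lam nu t t x -> M.[t] != 0.
  move=> hcol'; apply/eqP => Mt.
  have ht := collinear_on_curve hcol'.
  have {}Mt : 2 * (lam * t + nu) + A1 * t + A3 = 0.
    by rewrite -Mt /M /ylin !(hornerD, hornerM, hornerC, hornerX) ?hl; ring.
  apply: (smooth ht Mt).
  rewrite -[RHS](mulr0 lam) -Mt.
  by case: hcol' => e2 e4 _; rewrite e2 e4; ring.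
rewrite -[1](rmorph1 iota).
change (D 1).
have [e12|n12] := eqVneq x1 x2.
  subst x2; apply: (poly_ideal_double hD (dbl _ _ hcol)) => //; exact: DM.
have [e13|n13] := eqVneq x1 x3.
  subst x3; have /dbl := collinear_rot (collinear_rot hcol).
  by move=> /(poly_ideal_double hD); apply=> //; exact: DM.
have [e23|n23] := eqVneq x2 x3.
  subst x3; have /dbl := collinear_rot hcol.
  by move=> /(poly_ideal_double hD); apply=> //; exact: DM.
exact: poly_ideal_distinct n12 n13 n23 _ _ _.
Qed.

End PointIdeals.

(** * The group law *)

Section IdealClasses.
Variables (F : fieldType) (E : weierstrass).
Local Notation A := (coord_ring F E).
Implicit Types (I J K : set A).

(** Equality up to a factor in the fraction field, with the denominator cleared. *)
Definition same_class I J : Prop := exists a b : A,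
  [/\ a != 0, b != 0 & ideal_scale a I = ideal_scale b J].

Lemma same_class_refl I : same_class I I.
Proof. by exists 1, 1; rewrite oner_neq0. Qed.

Lemma same_class_sym I J : same_class I J -> same_class J I.
Proof. by case=> a [b [a0 b0 e]]; exists b, a. Qed.

Lemma same_class_trans I J K : same_class I J -> same_class J K -> same_class I K.
Proof.
case=> a [b [a0 b0 e]] [c [d [c0 d0 e']]]; exists (c * a), (b * d).
rewrite !coord_mulf_eq0 !negb_or a0 b0 c0 d0; split=> //.
by rewrite -!ideal_scaleA e -e' !ideal_scaleA mulrC.
Qed.

Lemma same_class_mul I J K : is_ideal I -> is_ideal J ->
  same_class I J -> same_class (ideal_mul I K) (ideal_mul J K).
Proof.
move=> hI hJ [a [b [a0 b0 e]]]; exists a, b; split=> //.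
by rewrite -!ideal_scale_mul ?e.
Qed.

Lemma same_class_scale a I : a != 0 -> same_class (ideal_scale a I) I.
Proof.
move=> a0; exists 1, a; split; rewrite ?oner_neq0 //.
by rewrite ideal_scaleA mul1r.
Qed.

End IdealClasses.

Section GroupLaw.
Variables (F : fieldType) (E : weierstrass).
Hypothesis disc_neq0 : (disc E)%:~R != 0 :> F.
Local Notation A1 := ((a1 E)%:~R : F).
Local Notation A2 := ((a2 E)%:~R : F).
Local Notation A3 := ((a3 E)%:~R : F).
Local Notation A4 := ((a4 E)%:~R : F).
Local Notation A6 := ((a6 E)%:~R : F).
Local Notation A := (coord_ring F E).
Local Notation iota := (@coord_poly F E).
Local Notation Y := (@coordY F E).
Implicit Types (P Q S T : ec_point F E).

(* Moving the point to the origin leaves the discriminant unchanged, and it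
   vanishes when a3 = a4 = a6 = 0. *)
Lemma ec_smooth (x y : F) : on_curve E (Some (x, y)) ->
  2 * y + A1 * x + A3 = 0 -> 3 * x ^+ 2 + 2 * A2 * x + A4 - A1 * y = 0 -> False.
Proof.
move=> /on_curveP hxy ey ex.
move: disc_neq0; rewrite /disc /b2 /b4 /b6 /b8.
rewrite !(rmorphD, rmorphN, rmorphM, rmorphXn) /=.
have e3 : A3 = - (2 * y + A1 * x) by rewrite -[RHS]addr0 -ey; ring.
have e4 : A4 = A1 * y - 3 * x ^+ 2 - 2 * A2 * x by rewrite -[RHS]addr0 -ex; ring.
have e6 : A6 = y ^+ 2 + A1 * x * y + A3 * y - x ^+ 3 - A2 * x ^+ 2 - A4 * x.
  by rewrite hxy; ring.
by rewrite e6 e4 e3 => /eqP; apply; ring.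
Qed.

Lemma opp_rawK (P : option (F * F)) : opp_raw E (opp_raw E P) = P.
Proof. by case: P => [[x y]|] //=; congr (Some (_, _)); ring. Qed.

Lemma opppK P : oppp (oppp P) = P.
Proof. by apply: ec_point_inj; rewrite /= opp_rawK. Qed.

Lemma polyXsubC_neq0 (x : F) : 'X - x%:P != 0 :> {poly F}.
Proof. exact: monic_neq0 (monicXsubC x). Qed.

Lemma pt_ideal_opp_principal P : exists2 v : A, v != 0 &
  ideal_mul (pt_ideal P) (pt_ideal (oppp P)) = ideal_scale v setT.
Proof.
case eP: (sval P) => [[x y]|].
  exists (iota ('X - x%:P)); first exact/coord_poly_neq0/polyXsubC_neq0.
  by rewrite (pt_ideal_opp ec_smooth eP).
exists 1; first exact: oner_neq0.
rewrite {2}/pt_ideal /= eP /= ideal_mulC ideal_mul1; last exact: is_ideal_pt.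
rewrite /pt_ideal eP; apply/seteqP; split=> // a _.
by exists a; rewrite ?mul1r.
Qed.

(** With S = P + Q, the line makes the product for P, Q, - S principal, and the vertical line makes
    the product for S, - S principal. *)
Lemma same_class_add P Q :
  same_class (pt_ideal (addp P Q)) (ideal_mul (pt_ideal P) (pt_ideal Q)).
Proof.
case eP: (sval P) => [[x1 y1]|]; last first.
  have -> : addp P Q = Q by apply: ec_point_inj; rewrite /= eP.
  rewrite {2}/pt_ideal eP ideal_mul1; last exact: is_ideal_pt.
  exact: same_class_refl.
case eQ: (sval Q) => [[x2 y2]|]; last first.
  have -> : addp P Q = P by apply: ec_point_inj; rewrite /= eP eQ.
  rewrite {3}/pt_ideal eQ ideal_mulC ideal_mul1; last exact: is_ideal_pt.
  exact: same_class_refl.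
have [hN|hN] := boolP ((x1 == x2) && (y1 + y2 + A1 * x2 + A3 == 0)).
  have -> : addp P Q = zerop F E by apply: ec_point_inj; rewrite /= eP eQ /= hN.
  have -> : Q = oppp P.
    apply: ec_point_inj; rewrite /= eP eQ /=.
    case/andP: hN => /eqP -> /eqP h0; congr (Some (_, _)).
    by rewrite -[RHS]addr0 -h0; ring.
  have [v v0 ->] := pt_ideal_opp_principal P.
  exact/same_class_sym/same_class_scale.
have [lam [nu [x3 [hcol ey1 ey2 eS]]]] := addp_collinear eP eQ (negbTE hN).
set S := addp P Q in eS *.
have eS' : sval (oppp S) = Some (x3, lam * x3 + nu) 
  by rewrite (_ : sval _ = opp_raw E (sval S)) // eS opp_rawK.
rewrite ey1 in eP; rewrite ey2 in eQ.
have eL := pt_ideal_collinear ec_smooth hcol eP eQ eS'.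
have [v v0 ev] := pt_ideal_opp_principal S.
have hPQ := is_ideal_mul (pt_ideal Q) (is_ideal_pt P).
have hS := is_ideal_pt S; have hS' := is_ideal_pt (oppp S).
(* With these multipliers, both sides are the product of the ideals of P, Q, S and - S. *)
exists (Y - iota (lam%:P * 'X + nu%:P)), v; split=> //; first exact: coord_line_neq0.
rewrite -[X in _ = ideal_scale v X](ideal_mul1 hPQ).
rewrite -ideal_scale_mul; last exact: is_idealT.
rewrite -ev -[in LHS](ideal_mul1 hS) -ideal_scale_mul; last exact: is_idealT.
rewrite -eL -ideal_mulA // [ideal_mul (pt_ideal (oppp S)) _]ideal_mulC.
by rewrite ideal_mulC.
Qed.

(* Otherwise both norms have degree at least 3, while their product has
   degree at most 4. *)
Lemma coord_factor_poly (c e : A) (p : {poly F}) : c * e = iota p -> p != 0 ->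
  (size p <= 3)%N -> c.2 = 0.
Proof.
move=> ece p0 sp; apply/eqP/negPn/negP => c20.
have c0 : c != 0 by apply: contraNneq c20 => ->.
have e0 : e != 0.
  by apply: contraNneq (coord_poly_neq0 E p0) => e0; rewrite -ece e0 mulr0.
have e20 : e.2 != 0.
  apply/negP => /eqP e20; have := congr1 snd ece.
  rewrite coordM /= e20 !(mulr0, mul0r) add0r subr0 => /eqP.
  rewrite mulf_eq0 (negPf c20) /= => /eqP e10.
  by move/eqP: e0; apply; case: (e) e10 e20 => u v /= -> ->.
have := congr1 (fun q : {poly F} => size q) (congr1 (@coord_norm F E) ece).
rewrite coord_normM coord_norm_poly expr2 !size_mul ?coord_norm_eq0 //.
rewrite !size_coord_norm // => hs.
have : (0 < size c.2)%N by rewrite size_poly_gt0.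
have : (0 < size e.2)%N by rewrite size_poly_gt0.
move: (size e.2) (size c.2) (size e.1) (size c.1) (size p) hs sp => *.
lia.
Qed.

Lemma scale_poly_comp (u : {poly F}) (a : A) :
  ideal_scale (iota u) setT a -> exists v, a.2 = u * v.
Proof.
case=> b _ <-; exists b.2; rewrite coordM /=; ring.
Qed.

(** For affine points, c divides (X - x1)(X - x2), hence is a polynomial in X, and it vanishes at
    x1. So the Y-component of every element of the product vanishes at x1: for (Y - y1)(X - x2) this
    gives x1 = x2, for (Y - y1)(Y - y2) it gives the ordinate of - P. With one point at infinity,
    the same argument shows that the ideal of an affine point is not principal. *)
Lemma pt_ideal_principal_opp P Q (c : A) :
  ideal_mul (pt_ideal P) (pt_ideal Q) = ideal_scale c setT -> Q = oppp P.
Proof.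
have affine1 S x y (d : A) : sval S = Some (x, y) -> pt_ideal S = ideal_scale d setT -> False.
  move=> eS hd.
  have [e _ hde] : ideal_scale d setT (iota ('X - x%:P)).
    by rewrite -hd; apply: pt_ideal_X eS.
  have d20 := coord_factor_poly hde (polyXsubC_neq0 x) _.
  have ed : d = iota d.1 by rewrite [LHS]coordE d20 ?size_XsubC // rmorph0 mul0r addr0.
  have [v] : exists v, (Y - iota y%:P).2 = d.1 * v.
    apply: scale_poly_comp; rewrite -ed -hd.
    by apply: (@pt_ideal_line _ _ _ x); rewrite hornerC.
  have : pt_ideal S d by rewrite hd; exists 1; rewrite ?mulr1.
  rewrite /pt_ideal eS /= /coord_eval d20 ?size_XsubC // horner0 mul0r addr0.
  move=> d1x /(congr1 (fun q => q.[x])) /eqP; rewrite hornerM d1x mul0r.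
  by rewrite /= subr0 hornerC oner_eq0.
move=> hPQ; case eP: (sval P) => [[x1 y1]|]; case eQ: (sval Q) => [[x2 y2]|].
- have hP := is_ideal_pt P; have hQ := is_ideal_pt Q.
  have hX1 := pt_ideal_X eP; have hX2 := pt_ideal_X eQ.
  have hY1 : pt_ideal P (Y - iota y1%:P) by apply: (@pt_ideal_line _ _ _ x1); rewrite hornerC.
  have hY2 : pt_ideal Q (Y - iota y2%:P) by apply: (@pt_ideal_line _ _ _ x2); rewrite hornerC.
  have [e _ hce] : ideal_scale c setT (iota (('X - x1%:P) * ('X - x2%:P))).
    by rewrite -hPQ rmorphM; apply: ideal_mul_gen.
  have c20 : c.2 = 0.
    apply: (coord_factor_poly hce); first by rewrite mulf_neq0 ?polyXsubC_neq0.
    by rewrite size_mul ?polyXsubC_neq0 // !size_XsubC.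
  have ec : c = iota c.1 by rewrite [LHS]coordE c20 rmorph0 mul0r addr0.
  have c1x : c.1.[x1] = 0.
    have : pt_ideal P c.
      have : ideal_mul (pt_ideal P) (pt_ideal Q) `<=` pt_ideal P.
        by apply: (ideal_mul_min hP) => a b ha _; rewrite mulrC; case: hP => _ _; apply.
      by apply; rewrite hPQ; exists 1; rewrite ?mulr1.
    by rewrite /pt_ideal eP /= /coord_eval c20 horner0 mul0r addr0.
  rewrite ec in hPQ.
  have comp0 a b : pt_ideal P a -> pt_ideal Q b -> (a * b).2.[x1] = 0.
    move=> ha hb; have := ideal_mul_gen ha hb; rewrite hPQ => /scale_poly_comp[v ->].
    by rewrite hornerM c1x mul0r.
  have e12 : x1 = x2.
    have := comp0 _ _ hY1 hX2; rewrite coordM /= !(mulr0, mul0r, subr0, add0r, mul1r).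
    by rewrite !hornerE => /eqP; rewrite subr_eq0 => /eqP.
  have := comp0 _ _ hY1 hY2.
  rewrite coordM /= !(mulr0, mul0r, subr0, sub0r, mul1r, mulr1) /ylin.
  rewrite !(hornerD, hornerN, hornerM, hornerC, hornerX) => ey.
  apply: ec_point_inj; rewrite /= eP eQ /= e12; congr (Some (_, _)).
  by rewrite -[LHS]addr0 -ey e12; ring.
- case: (affine1 P x1 y1 c eP).
  by rewrite -hPQ ideal_mulC {2}/pt_ideal eQ ideal_mul1 //; apply: is_ideal_pt.
- case: (affine1 Q x2 y2 c eQ).
  by rewrite -hPQ {2}/pt_ideal eP ideal_mul1 //; apply: is_ideal_pt.
- by apply: ec_point_inj; rewrite /= eP eQ.
Qed.

(** Multiplication by the ideal of - Q makes the right-hand class principal, so the ideals of P and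
    - Q have a principal product. *)
Lemma pt_ideal_class_inj P Q : same_class (pt_ideal P) (pt_ideal Q) -> P = Q.
Proof.
case=> a [b [a0 b0 e]].
have [v v0 hv] := pt_ideal_opp_principal Q.
have hP := is_ideal_pt P; have hQ := is_ideal_pt Q.
have e' : ideal_scale a (ideal_mul (pt_ideal P) (pt_ideal (oppp Q)))
    = ideal_scale (b * v) setT.
  by rewrite -ideal_scaleA -hv -!ideal_scale_mul ?e.
have [c _ hc] : exists2 c, True & a * c = b * v.
  have : ideal_scale (b * v) setT (b * v) by exists 1; rewrite ?mulr1.
  by rewrite -e' => -[c _ <-]; exists c.
rewrite -hc -ideal_scaleA in e'.
have := ideal_scale_inj (coord_mulfI a0) e' => /pt_ideal_principal_opp h.
by rewrite -[P]opppK -h opppK.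
Qed.

Lemma addpA : associative (@addp F E).
Proof.
move=> P Q S; apply: pt_ideal_class_inj.
have hP := is_ideal_pt P; have hQ := is_ideal_pt Q; have hS := is_ideal_pt S.
have hQS := is_ideal_mul (pt_ideal S) hQ; have hPQ := is_ideal_mul (pt_ideal Q) hP.
apply: (same_class_trans (same_class_add _ _)); rewrite ideal_mulC.
apply: (same_class_trans (same_class_mul _ _ hQS (same_class_add _ _))).
  exact: is_ideal_pt.
rewrite ideal_mulC ideal_mulA //; apply: same_class_sym.
apply: (same_class_trans (same_class_add _ _)).
by apply: (same_class_mul _ _ hPQ (same_class_add _ _)); apply: is_ideal_pt.
Qed.

Lemma addpC : commutative (@addp F E).
Proof.
move=> P Q; apply: pt_ideal_class_inj.
apply: (same_class_trans (same_class_add _ _)).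
by rewrite ideal_mulC; apply/same_class_sym/same_class_add.
Qed.

Lemma add0p : left_id (zerop F E) (@addp F E).
Proof. by move=> P; apply: ec_point_inj. Qed.

Lemma addNp : left_inverse (zerop F E) (@oppp F E) (@addp F E).
Proof.
move=> P; apply: ec_point_inj => /=; case: (sval P) => [[x y]|] //=.
by rewrite eqxx (_ : _ + _ = 0) ?eqxx //; ring.
Qed.

(** Unlike [addp_collinear], this starts from the equations of the line. It serves over the residue
    field, where points may collide although the points above them are distinct; ideal classes
    handle every collision at once. *)
Lemma collinear_addp P Q S lam nu x1 x2 x3 : collinear E lam nu x1 x2 x3 ->
  sval P = Some (x1, lam * x1 + nu) -> sval Q = Some (x2, lam * x2 + nu) ->
  sval S = Some (x3, lam * x3 + nu) -> addp P Q = oppp S.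
Proof.
move=> hcol eP eQ eS.
have hPQ := pt_ideal_collinear ec_smooth hcol eP eQ eS.
have [v v0 hv] := pt_ideal_opp_principal (oppp S); rewrite opppK in hv.
apply: pt_ideal_class_inj; apply: (same_class_trans (same_class_add P Q)).
have hS := is_ideal_pt (oppp S).
have hPQ' := is_ideal_mul (pt_ideal Q) (is_ideal_pt P).
exists v, (Y - iota (lam%:P * 'X + nu%:P)); split=> //; first exact: coord_line_neq0.
rewrite -[in LHS](ideal_mul1 hPQ') -ideal_scale_mul; last exact: is_idealT.
rewrite -hv -[in RHS](ideal_mul1 hS) -ideal_scale_mul; last exact: is_idealT.
rewrite -hPQ [RHS]ideal_mulC -ideal_mulA // [ideal_mul (pt_ideal S) _]ideal_mulC //.
Qed.

End GroupLaw.

(** The proof that the discriminant is nonzero is an argument of the type, so that the group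
    structure can be attached canonically. *)
Definition ec_group (F : fieldType) (E : weierstrass)
  of (disc E)%:~R != 0 :> F : Type := ec_point F E.

Section GroupInstance.
Variables (F : fieldType) (E : weierstrass) (hE : (disc E)%:~R != 0 :> F).

HB.instance Definition _ := Choice.copy (ec_group hE) (ec_point F E).
HB.instance Definition _ := GRing.isZmodule.Build (ec_group hE)
  (addpA hE) (addpC hE) (@add0p F E) (@addNp F E).

End GroupInstance.

(** * Reduction is a morphism *)

Lemma frac_lowest_terms (z : rat) (n d : int) : d != 0 -> z = n%:~R / d%:~R ->
  exists k, n = k * numq z /\ d = k * denq z.
Proof.
move=> d0 ezq; have dQ : d%:~R != 0 :> rat by rewrite intr_eq0.
have ez : numq z * d = n * denq z.
  apply: (@intr_inj rat); rewrite !rmorphM /=.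
  have := divq_num_den z; rewrite {3}ezq => /eqP.
  by rewrite eqr_div ?dQ ?intr_eq0 ?denq_neq0 // => /eqP.
have /dvdzP[k ek] : (denq z %| d)%Z.
  rewrite -(@Gauss_dvdzr _ (numq z)); last first.
    by rewrite coprimez_sym; exact: coprime_num_den.
  by rewrite ez dvdz_mull.
exists k; split=> //; apply: (mulIf (denq_neq0 z)); rewrite -ez ek; ring.
Qed.

Section Residues.
Variable F : fieldType.
Implicit Types (z : rat) (r : F).

(* The place of rat attached to the characteristic of F: z is integral with
   residue r. *)
Definition residue z r : Prop := exists n d : int,
  [/\ z = n%:~R / d%:~R, d%:~R != 0 :> F & r = n%:~R / d%:~R].

Lemma charF_int_neq0 (d : int) : d%:~R != 0 :> F -> d%:~R != 0 :> rat.
Proof. by apply: contraNneq => /eqP; rewrite intr_eq0 => /eqP ->. Qed.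

Lemma residue_ratr z r : residue z r -> (denq z)%:~R != 0 :> F /\ ratr z = r.
Proof.
case=> n [d [ez d0 ->]].
have dZ : d != 0 by apply: contraNneq d0 => ->.
have [k [en ed]] := frac_lowest_terms dZ ez.
move: d0; rewrite en ed !rmorphM /= mulf_eq0 negb_or => /andP[k0 d0].
by split=> //; rewrite /ratr -mulf_div divff // mul1r.
Qed.

Lemma residue_uniq z r r' : residue z r -> residue z r' -> r = r'.
Proof. by move=> /residue_ratr[_ <-] /residue_ratr[_ <-]. Qed.

Lemma residue_int (n : int) : residue n%:~R n%:~R.
Proof. by exists n, 1; rewrite !divr1 oner_neq0. Qed.

Lemma residue0 : residue 0 0. Proof. exact: (residue_int 0). Qed.
Lemma residue1 : residue 1 1. Proof. exact: (residue_int 1). Qed.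

Lemma residueD z1 z2 r1 r2 :
  residue z1 r1 -> residue z2 r2 -> residue (z1 + z2) (r1 + r2).
Proof.
case=> n1 [d1 [-> h1 ->]] [n2 [d2 [-> h2 ->]]].
exists (n1 * d2 + n2 * d1), (d1 * d2).
rewrite !(rmorphD, rmorphM) /= mulf_neq0 //; split=> //.
  by field; rewrite !charF_int_neq0.
by field; rewrite h1 h2.
Qed.

Lemma residueM z1 z2 r1 r2 :
  residue z1 r1 -> residue z2 r2 -> residue (z1 * z2) (r1 * r2).
Proof.
case=> n1 [d1 [-> h1 ->]] [n2 [d2 [-> h2 ->]]]; exists (n1 * n2), (d1 * d2).
by rewrite !rmorphM /= mulf_neq0 // !mulf_div.
Qed.

Lemma residueN z r : residue z r -> residue (- z) (- r).
Proof.
case=> n [d [-> d0 ->]]; exists (- n), d.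
by rewrite !rmorphN /= !mulNr.
Qed.

Lemma residueB z1 z2 r1 r2 :
  residue z1 r1 -> residue z2 r2 -> residue (z1 - z2) (r1 - r2).
Proof. by move=> h1 /residueN; apply: residueD. Qed.

Lemma residueX z r n : residue z r -> residue (z ^+ n) (r ^+ n).
Proof.
move=> h; elim: n => [|n IH]; first exact: residue1.
by rewrite !exprS; apply: residueM.
Qed.

Lemma residueV z r : r != 0 -> residue z r -> residue z^-1 r^-1.
Proof.
move=> r0 [n [d [-> d0 er]]]; exists d, n; rewrite er !invf_div; split=> //.
by apply: contraNneq r0; rewrite er => ->; rewrite mul0r.
Qed.

Lemma residue_neq0 z r : r != 0 -> residue z r -> z != 0.
Proof.
move=> r0 h; apply: contraNneq r0 => z0; rewrite z0 in h.
by rewrite (residue_uniq h residue0).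
Qed.

Lemma residue_nat n : residue n%:R n%:R.
Proof. by have := residue_int n; rewrite -!pmulrn. Qed.

Lemma residue_dichotomy z :
  [/\ z != 0, (denq z)%:~R = 0 :> F & residue z^-1 0] \/ exists r, residue z r.
Proof.
have [d0|d0] := eqVneq ((denq z)%:~R : F) 0; [left|right]; last first.
  by exists (ratr z), (numq z), (denq z); rewrite divq_num_den.
have n0 : (numq z)%:~R != 0 :> F.
  have /coprimezP[[c d] /= e] : coprimez (numq z) (denq z) by exact: coprime_num_den.
  have := congr1 (fun z : int => z%:~R : F) e.
  rewrite /= rmorphD !rmorphM /= d0 mulr0 addr0 => e1.
  by apply/eqP => e0; move/eqP: e1; rewrite e0 mulr0 eq_sym oner_eq0.
split=> //; first by apply: contraNneq n0 => ->.
by exists (denq z), (numq z); rewrite d0 mul0r -{1}(divq_num_den z) invf_div.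
Qed.

End Residues.

Ltac residue_tac := repeat first
  [ eassumption | exact: residue0 | exact: residue1 | apply: residue_int
  | apply: residue_nat | apply: residueB | apply: residueD | apply: residueM
  | apply: residueN | apply: residueX ].

Section ReductionMorphism.
Variables (F : fieldType) (E : weierstrass).
Hypothesis disc_neq0 : (disc E)%:~R != 0 :> F.
Notation res := (@residue F).
Implicit Types (P Q S : ec_point rat E).

Lemma disc_rat_neq0 : (disc E)%:~R != 0 :> rat.
Proof. exact: charF_int_neq0 disc_neq0. Qed.
Let discQ := disc_rat_neq0.

Lemma residue_eq01 z : res z 0 -> z = 1 -> False.
Proof.
move=> h e; rewrite e in h; have := residue_uniq h (residue1 F) => /eqP.
by rewrite eq_sym oner_eq0.
Qed.

Variant reduce_spec P : option (rat * rat) -> option (F * F) -> Prop :=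
  | ReduceZero : reduce_spec P None None
  | ReduceKernel x y of x != 0 & res x^-1 0 : reduce_spec P (Some (x, y)) None
  | ReduceAffine x y r s of res x r & res y s :
      reduce_spec P (Some (x, y)) (Some (r, s)).

Lemma reduceP P : reduce_spec P (sval P) (sval (reduce F P)).
Proof.
rewrite /=; case: P => [[[x y]|] hP] /=; last by constructor.
have [[x0 -> rx]|[r hr]] := residue_dichotomy F x.
  by rewrite eqxx; constructor.
have [dx ->] := residue_ratr hr; rewrite (negPf dx).
have [[y0 dy ry]|[s hs]] := residue_dichotomy F y; last first.
  by have [_ ->] := residue_ratr hs; constructor.
(* An integral x forces an integral y: otherwise the curve equation divided by y ^ 2 would give 1
   the residue 0. *)
case: (@residue_eq01 (y^-1 * (y^-1 * (x ^+ 3 + (a2 E)%:~R * x ^+ 2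
  + (a4 E)%:~R * x + (a6 E)%:~R) - (a1 E)%:~R * x - (a3 E)%:~R))).
  rewrite -[0](mul0r (0 * (r ^+ 3 + (a2 E)%:~R * r ^+ 2
  + (a4 E)%:~R * r + (a6 E)%:~R) - (a1 E)%:~R * r - (a3 E)%:~R)).
  by residue_tac.
by move/on_curveP: hP => <-; field.
Qed.

Lemma reduce_affineP P : sval (reduce F P) != None -> exists x y r s,
  [/\ sval P = Some (x, y), sval (reduce F P) = Some (r, s), res x r & res y s].
Proof. by case: (reduceP P) => // x y r s rx ry _; exists x, y, r, s. Qed.

Lemma reduce_kernelP P : reduce F P = zerop F E ->
  P = zerop rat E \/ exists x y, [/\ sval P = Some (x, y), x != 0 & res x^-1 0].
Proof.
move=> /(congr1 sval); move eP: (sval P) (reduceP P) => p hp.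
case: hp eP => // [eP|x y x0 rx eP] _; first by left; apply: ec_point_inj.
by right; exists x, y.
Qed.

Lemma reduce_zero : reduce F (zerop rat E) = zerop F E.
Proof. exact: ec_point_inj. Qed.

Lemma reduce_opp P : reduce F (oppp P) = oppp (reduce F P).
Proof.
apply: ec_point_inj.
have e1 : sval (oppp P) = opp_raw E (sval P) by [].
have e2 : sval (oppp (reduce F P)) = opp_raw E (sval (reduce F P)) by [].
rewrite e2; move: e1.
case: (reduceP P) => [|x y x0 rx|x y r s rx ry]; case: (reduceP (oppp P)) => //.
- move=> x' y' r' s' rx' _ [ex _]; case: (@residue_eq01 (x^-1 * x')).
    by rewrite -(mul0r r'); apply: residueM.
  by rewrite ex mulVf.
- move=> x' y' x0' rx' [ex _]; case: (@residue_eq01 (x'^-1 * x)).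
    by rewrite -(mul0r r); apply: residueM.
  by rewrite -ex mulVf.
- move=> x' y' r' s' rx' ry' [ex ey].
  rewrite ex in rx'; rewrite ey in ry'; congr (Some (_, _)).
    exact: residue_uniq rx' rx.
  by apply: (residue_uniq ry'); residue_tac.
Qed.

Lemma addp_opp_raw (K : fieldType) (hK : (disc E)%:~R != 0 :> K) (P Q : ec_point K E) :
  sval Q = opp_raw E (sval P) -> addp P Q = zerop K E.
Proof.
move=> e; have -> : Q = oppp P by apply: ec_point_inj.
by rewrite (addpC hK) addNp.
Qed.


(* If the slope is integral, the line itself reduces; otherwise P and Q reduce
   to opposite points and the third point to the point at infinity. *)
Lemma reduce_add_affine P Q :
  sval (reduce F P) != None -> sval (reduce F Q) != None ->
  reduce F (addp P Q) = addp (reduce F P) (reduce F Q).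
Proof.
move=> /reduce_affineP[x1 [y1 [r1 [s1 [eP eP' rx1 ry1]]]]].
move=> /reduce_affineP[x2 [y2 [r2 [s2 [eQ eQ' rx2 ry2]]]]].
have [hN|hN] := boolP ((x1 == x2) && (y1 + y2 + (a1 E)%:~R * x2 + (a3 E)%:~R == 0)).
  have eQP : sval Q = opp_raw E (sval P).
    rewrite eP eQ /=; case/andP: hN => /eqP -> /eqP h0; congr (Some (_, _)).
    by rewrite -[RHS]addr0 -h0; ring.
  have -> : Q = oppp P by apply: ec_point_inj.
  rewrite reduce_opp (addpC disc_neq0) addNp.
  by rewrite (addpC discQ) addNp reduce_zero.
have [lam [nu [x3 [hcol ey1 ey2 eS]]]] := addp_collinear eP eQ (negbTE hN).
have [c2 c4 c6] := hcol.
have enu : nu = y1 - lam * x1 by rewrite ey1; ring.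
have ex3 : x3 = lam ^+ 2 + (a1 E)%:~R * lam - (a2 E)%:~R - x1 - x2.
  by rewrite c2; ring.
have eopp : sval (oppp (addp P Q)) = Some (x3, lam * x3 + nu).
  by rewrite (_ : sval _ = opp_raw E (sval (addp P Q))) // eS opp_rawK.
have [[lam0 _ rlam]|[l rl]] := residue_dichotomy F lam.
  (* The slope has a pole, and x3 is [lam ^+ 2] times this factor of residue 1; so x3 has a pole as
     well. *)
  have rd : res (1 + (a1 E)%:~R * lam^-1 - ((a2 E)%:~R + x1 + x2) * lam^-1 ^+ 2) 1.
    rewrite -[X in res _ X](_ : 1 + (a1 E)%:~R * 0 - ((a2 E)%:~R + r1 + r2) * 0 ^+ 2 = 1); last by ring.
    by residue_tac.
  set d := (X in res X 1) in rd.
  have d0 : d != 0 by apply: residue_neq0 rd; rewrite oner_neq0.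
  have ed : x3 = lam ^+ 2 * d by rewrite ex3 /d; field.
  have rx3 : res x3^-1 0.
    have := residueM (residueM rlam rlam) (residueV (oner_neq0 F) rd).
    by rewrite ed invfM -exprVn expr2 !mul0r.
  have -> : reduce F (addp P Q) = zerop F E.
    apply: (can_inj (@opppK F E)); rewrite -reduce_opp; apply: ec_point_inj.
    case: (reduceP (oppp (addp P Q))) eopp => // x' y' r' s' rx' _ [ex' _].
    case: (@residue_eq01 (x3^-1 * x')); first by rewrite -(mul0r r'); apply: residueM.
    by rewrite ex' mulVf // ed mulf_neq0 // expf_neq0.
  apply/esym/addp_opp_raw => //; rewrite eP' eQ' /=.
  have er : r1 = r2.
    apply/eqP; rewrite -subr_eq0; apply/eqP.
    have -> : 0 = (s1 - s2) * 0 :> F by rewrite mulr0.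
    apply: (@residue_uniq _ (x1 - x2)); first by residue_tac.
    have -> : x1 - x2 = (y1 - y2) * lam^-1 by rewrite ey1 ey2; field.
    by residue_tac.
  congr (Some (_, _)) => //; apply/eqP; rewrite -subr_eq0; apply/eqP.
  have -> : 0 = (r1 ^+ 2 + r1 * r2 + r2 ^+ 2 + (a2 E)%:~R * (r1 + r2) + (a4 E)%:~R
                - (a1 E)%:~R * s1) * 0 by rewrite mulr0.
  apply: (@residue_uniq _ (y2 - (- y1 - (a1 E)%:~R * x2 - (a3 E)%:~R))).
    by rewrite {1}er; residue_tac.
  (* For a chord this is the difference of the two curve equations divided by y2 - y1; it holds for
     a tangent too. *)
  have -> : y2 - (- y1 - (a1 E)%:~R * x2 - (a3 E)%:~R)
    = (x1 ^+ 2 + x1 * x2 + x2 ^+ 2 + (a2 E)%:~R * (x1 + x2) + (a4 E)%:~R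
       - (a1 E)%:~R * y1) * lam^-1.
    by rewrite c4 c2 ey1 ey2; field.
  by residue_tac.
have rnu : res nu (s1 - l * r1) by rewrite enu; residue_tac.
set n := s1 - l * r1 in rnu.
have [r3 rx3] : exists r3, res x3 r3 by eexists; rewrite ex3; residue_tac.
have hcolF : collinear E l n r1 r2 r3.
  split.
  - by apply: (residue_uniq (residue_int F (a2 E))); rewrite c2; residue_tac.
  - by apply: (residue_uniq (residue_int F (a4 E))); rewrite c4; residue_tac.
  - by apply: (residue_uniq (residue_int F (a6 E))); rewrite c6; residue_tac.
have es1 : s1 = l * r1 + n by rewrite /n; ring.
have es2 : s2 = l * r2 + n.
  by apply: (residue_uniq ry2); rewrite ey2; residue_tac.
rewrite es1 in eP'; rewrite es2 in eQ'.
have eS' : sval (reduce F (oppp (addp P Q))) = Some (r3, l * r3 + n).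
  case: (reduceP (oppp (addp P Q))) eopp => // [x' y' x0' rx' [ex' _]|x' y' r' s' rx' ry' [ex' ey']].
    case: (@residue_eq01 (x'^-1 * x3)); last by rewrite -ex' mulVf.
    by rewrite -(mul0r r3); apply: residueM.
  rewrite ex' in rx'; rewrite ey' in ry'.
  congr (Some (_, _)); first exact: residue_uniq rx' rx3.
  by apply: (residue_uniq ry'); residue_tac.
rewrite (collinear_addp disc_neq0 hcolF eP' eQ' eS') reduce_opp.
by rewrite opppK.
Qed.

(* Dividing the equation for A4 by x1 x2 leaves 1 = 0 in the residue field. *)
Lemma reduce_add_kernel P Q :
  reduce F P = zerop F E -> reduce F Q = zerop F E ->
  reduce F (addp P Q) = zerop F E.
Proof.
move=> zP zQ.
case: (reduce_kernelP zP) => [->|[x1 [y1 [eP x10 rx1]]]]; first by rewrite add0p.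
case: (reduce_kernelP zQ) => [->|[x2 [y2 [eQ x20 rx2]]]].
  by rewrite (addpC discQ) add0p.
have [hN|hN] := boolP ((x1 == x2) && (y1 + y2 + (a1 E)%:~R * x2 + (a3 E)%:~R == 0)).
  rewrite (_ : addp P Q = zerop rat E) ?reduce_zero //.
  by apply: ec_point_inj; rewrite /= eP eQ /= hN.
have [lam [nu [x3 [[c2 c4 c6] _ _ eS]]]] := addp_collinear eP eQ (negbTE hN).
have eopp : sval (oppp (addp P Q)) = Some (x3, lam * x3 + nu).
  by rewrite (_ : sval _ = opp_raw E (sval (addp P Q))) // eS opp_rawK.
apply: (can_inj (@opppK F E)); rewrite -reduce_opp; apply: ec_point_inj.
case: (reduceP (oppp (addp P Q))) eopp => // x' y3 r3 s3 rx3 ry3 [ex ey].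
rewrite {}ex in rx3; have enu : nu = y3 - lam * x3 by rewrite ey; ring.
pose u := x1^-1 * x2^-1.
have ru : res u 0 by rewrite -(mul0r (0 : F)); apply: residueM.
have [r1 r2] : res (lam * u) 0 /\ res (lam ^+ 2 * u) 0.
  have [[lam0 _ rk]|[l rl]] := residue_dichotomy F lam; last first.
    split; first by rewrite -(mulr0 l); apply: residueM.
    by rewrite -(mulr0 (l ^+ 2)); residue_tac.
  have rd : res (1 + (a1 E)%:~R * lam^-1) 1.
    by rewrite -[X in res _ X](_ : 1 + (a1 E)%:~R * 0 = 1); [residue_tac | ring].
  have d0 := residue_neq0 (oner_neq0 F) rd.
  have r2 : res (lam ^+ 2 * u) 0.
    (* The equation for A2 times u: it controls the pole of the slope by those of x1 and x2, as x3
       is assumed integral. *)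
    have -> : lam ^+ 2 * u = ((a2 E)%:~R * u + x2^-1 + x1^-1 + x3 * u)
        * (1 + (a1 E)%:~R * lam^-1)^-1.
      apply: (mulIf d0); rewrite divfK // c2 /u; field.
      by rewrite x10 x20 lam0.
    have -> : 0 = ((a2 E)%:~R * 0 + 0 + 0 + r3 * 0) * 1^-1 :> F by rewrite !mulr0; ring.
    by apply: residueM; [residue_tac | apply: residueV rd; rewrite oner_neq0].
  split=> //.
  have -> : lam * u = lam ^+ 2 * u * lam^-1 by field.
  by rewrite -(mulr0 (0 : F)); apply: residueM.
case: (@residue_eq01 ((a4 E)%:~R * u - 2 * (y3 * (lam * u) - x3 * (lam ^+ 2 * u))
   - (a1 E)%:~R * (y3 * u - x3 * (lam * u)) - (a3 E)%:~R * (lam * u)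
   - x3 * x2^-1 - x3 * x1^-1)).
  have -> : 0 = (a4 E)%:~R * 0 - 2 * (s3 * 0 - r3 * 0)
   - (a1 E)%:~R * (s3 * 0 - r3 * 0) - (a3 E)%:~R * 0 - r3 * 0 - r3 * 0 :> F by ring.
  by residue_tac.
by rewrite c4 enu /u; field; rewrite x10 x20.
Qed.

(** P + Q stays affine, since otherwise P = (P + Q) - Q would lie in the kernel. Then Q = (P + Q) +
    (- P) is a sum of affine reductions, already treated. *)
Lemma reduce_add_mixed P Q : sval (reduce F P) != None ->
  reduce F Q = zerop F E -> reduce F (addp P Q) = reduce F P.
Proof.
move=> aP zQ; have [zR|aR] := eqVneq (sval (reduce F (addp P Q))) None.
  have zR' : reduce F (addp P Q) = zerop F E by apply: ec_point_inj.
  have eP : P = addp (addp P Q) (oppp Q).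
    by rewrite -(addpA discQ) (addpC discQ Q) addNp (addpC discQ) add0p.
  case/eqP: aP; rewrite eP reduce_add_kernel // reduce_opp zQ.
  exact: ec_point_inj.
have eQ : Q = addp (addp P Q) (oppp P).
  by rewrite (addpC discQ P) -(addpA discQ) (addpC discQ P) addNp (addpC discQ) add0p.
have aP' : sval (reduce F (oppp P)) != None.
  rewrite reduce_opp (_ : sval _ = opp_raw E (sval (reduce F P))) //.
  by case: (sval (reduce F P)) aP => [[]|].
have := reduce_add_affine aR aP'; rewrite -eQ zQ reduce_opp => e0.
rewrite -[LHS](add0p) (addpC disc_neq0) -(addNp (reduce F P)).
by rewrite (addpA disc_neq0) -e0 add0p.
Qed.

Lemma reduce_add P Q : reduce F (addp P Q) = addp (reduce F P) (reduce F Q).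
Proof.
have [zP|aP] := eqVneq (sval (reduce F P)) None; have [zQ|aQ] := eqVneq (sval (reduce F Q)) None.
- have {}zP : reduce F P = zerop F E by apply: ec_point_inj.
  have {}zQ : reduce F Q = zerop F E by apply: ec_point_inj.
  by rewrite reduce_add_kernel // zP zQ add0p.
- have {}zP : reduce F P = zerop F E by apply: ec_point_inj.
  by rewrite (addpC discQ) reduce_add_mixed // zP add0p.
- have {}zQ : reduce F Q = zerop F E by apply: ec_point_inj.
  by rewrite reduce_add_mixed // zQ (addpC disc_neq0) add0p.
- exact: reduce_add_affine.
Qed.

End ReductionMorphism.

(** * Counting *)

Section Pigeonhole.
Variables (G : zmodType) (T : finType) (f : G -> T).
Hypothesis f_inj : injective f.

(** More than #|T| pairs (i, j) are available with i < K and j at most #|T| / K. Two pairs with the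
    same sum b i + a j have distinct j, because the multiples of b below K are distinct. *)
Lemma multiple_in_subgroup (H : set G) (a b : G) (K : nat) : (0 < K)%N ->
  H 0 -> (forall x y, H x -> H y -> H (x - y)) -> H b ->
  (forall i, (0 < i < K)%N -> b *+ i != 0) ->
  exists n, [/\ (0 < n)%N, (n * K <= #|T|)%N & H (a *+ n)].
Proof.
move=> K0 H0 HB Hb bK.
have HN x : H x -> H (- x) by move=> Hx; rewrite -sub0r; apply: HB.
have HD x y : H x -> H y -> H (x + y).
  by move=> Hx Hy; rewrite -[y]opprK; apply/HB/HN.
have Hbn n : H (b *+ n) by elim: n => [//|n IH]; rewrite mulrS; apply: HD.
set N := (#|T| %/ K).+1.
pose g (u : 'I_K * 'I_N) := f (b *+ u.1 + a *+ u.2).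
have /injectivePn[u [v uv /f_inj guv]] : ~~ injectiveb g.
  apply/negP => /injectiveP/leq_card; rewrite card_prod !card_ord leqNgt.
  by rewrite /N mulnC ltn_ceil.
wlog le_uv : u v uv guv / (u.2 <= v.2)%N.
  move=> IH; case: (leqP u.2 v.2) => [|/ltnW]; first exact: IH guv.
  by apply: (IH v u); rewrite // eq_sym.
have eab : a *+ (v.2 - u.2) = b *+ u.1 - b *+ v.1.
  by rewrite mulrnBr //; apply/eqP; rewrite subr_eq addrAC guv addrAC subrr add0r.
exists (v.2 - u.2)%N; split.
- rewrite subn_gt0 ltn_neqAle le_uv andbT; apply: contraNneq uv => e2.
  move: eab; rewrite e2 subnn mulr0n => /esym/eqP; rewrite subr_eq0 => /eqP eb.
  suff e1 : u.1 = v.1 by case: u v e1 e2 {guv le_uv eb} => [u1 u2] [v1 v2] /= -> /val_inj ->.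
  apply/val_inj/eqP; case: ltngtP => // lt; exfalso.
    have h1 : (0 < v.1 - u.1 < K)%N.
      by rewrite subn_gt0 lt /= (leq_ltn_trans (leq_subr _ _) (ltn_ord _)).
    by have := bK _ h1; rewrite (mulrnBr _ (ltnW lt)) eb subrr eqxx.
  have h1 : (0 < u.1 - v.1 < K)%N.
    by rewrite subn_gt0 lt /= (leq_ltn_trans (leq_subr _ _) (ltn_ord _)).
  by have := bK _ h1; rewrite (mulrnBr _ (ltnW lt)) eb subrr eqxx.
- rewrite -leq_divRL // (leq_trans (leq_subr _ _)) // -ltnS.
  exact: ltn_ord.
- by rewrite eab; apply: HB.
Qed.

End Pigeonhole.

(** * Points over a finite field *)

Section PointCount.
Variables (F : finFieldType) (E : weierstrass).

(** An abscissa carries at most two ordinates, so one bit tells whether the ordinate is the one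
    selected by [pick]. *)
Definition pt_code (P : ec_point F E) : option (F * bool) :=
  if sval P is Some (x, y)
  then Some (x, Some y == [pick z | on_curve E (Some (x, z))]) else None.

Lemma pt_code_inj : injective pt_code.
Proof.
move=> [[[x y]|] hP] [[[x' y']|] hQ] //= h; apply: ec_point_inj => //=.
move: h; rewrite /pt_code /= => -[ex]; subst x'.
case: pickP => [z hz|h0]; last by case/negP: (negbT (h0 y)).
have quad u v : on_curve E (Some (x, u)) -> on_curve E (Some (x, v)) -> u != v ->
    u + v + (a1 E)%:~R * x + (a3 E)%:~R = 0 :> F.
  move=> /on_curveP hu /on_curveP hv; rewrite -subr_eq0 => nuv.
  apply: (mulfI nuv); rewrite mulr0.
  transitivity ((u ^+ 2 + (a1 E)%:~R * x * u + (a3 E)%:~R * u)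
    - (v ^+ 2 + (a1 E)%:~R * x * v + (a3 E)%:~R * v)); first by ring.
  by rewrite hu hv subrr.
have [->|nyz] := eqVneq y z; first by rewrite eqxx => /esym/eqP[->].
rewrite [LHS](_ : _ = false); last by apply/negP => /eqP[/eqP]; rewrite (negPf nyz).
move=> /esym/negbT => ny'z.
have {}ny'z : y' != z by apply: contraNneq ny'z => ->.
have e := quad _ _ hP hz nyz; have e' := quad _ _ hQ hz ny'z.
congr (Some (_, _)); apply/eqP; rewrite -subr_eq0; apply/eqP.
transitivity ((y + z + (a1 E)%:~R * x + (a3 E)%:~R)
   - (y' + z + (a1 E)%:~R * x + (a3 E)%:~R)); first by ring.
by rewrite e e' subrr.
Qed.

Lemma card_pt_code : #|{: option (F * bool)}| = (#|F|.*2).+1.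
Proof. by rewrite card_option card_prod card_bool muln2. Qed.

End PointCount.

(* A common multiple of 1, ..., 2 ^ k: a prime power in the interval
   ]2 ^ k, 2 ^ k.+1] contributes one new prime factor, which divides the
   central binomial coefficient. *)
Definition smooth_multiple (k : nat) : nat :=
  \prod_(j < k) 'C((2 ^ j).*2, 2 ^ j).

Lemma bin_leq_exp2 n m : ('C(n, m) <= 2 ^ n)%N.
Proof.
elim: n m => [|n IH] [|m]; rewrite ?bin0 ?expn_gt0 //.
by rewrite binS expnS mul2n -addnn leq_add.
Qed.

Lemma smooth_multiple_gt0 k : (0 < smooth_multiple k)%N.
Proof.
by rewrite /smooth_multiple prodn_gt0 // => j; rewrite bin_gt0 -addnn leq_addr.
Qed.

Lemma smooth_multiple_le k : (smooth_multiple k <= 4 ^ 2 ^ k)%N.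
Proof.
elim: k => [|k IH]; first by rewrite /smooth_multiple big_ord0.
rewrite /smooth_multiple big_ord_recr /= expnS mul2n -addnn expnD.
apply: leq_mul; first exact: IH.
by rewrite (leq_trans (bin_leq_exp2 _ _)) // addnn -mul2n expnM.
Qed.

(** Legendre's formula: the quotient of 2 n by p ^ i is at least twice that of n, and for i = a the
    former is positive while the latter is 0. *)
Lemma prime_dvd_central_bin p a n : prime p -> (n < p ^ a <= n.*2)%N ->
  (p %| 'C(n.*2, n))%N.
Proof.
move=> p_pr /andP[lt_n le_2n].
have bin0 : (0 < 'C(n.*2, n))%N by rewrite bin_gt0 -addnn leq_addr.
have fact_eq : ('C(n.*2, n) * (n`! * n`!) = (n.*2)`!)%N.
  have := @bin_fact n.*2 n; rewrite -addnn addnK => -> //.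
  exact: leq_addr.
have := congr1 (logn p) fact_eq.
rewrite !lognM ?muln_gt0 ?fact_gt0 // !logn_fact // => elog.
have a0 : (0 < a)%N by case: a lt_n le_2n => //; lia.
have le_a : (a <= n.*2)%N.
  by apply: (leq_trans _ le_2n); apply/ltnW/ltn_expl/prime_gt1.
have ext : (\sum_(1 <= i < n.+1) n %/ p ^ i = \sum_(1 <= i < n.*2.+1) n %/ p ^ i)%N.
  rewrite [RHS](@big_cat_nat _ _ _ n.+1) //=; last by rewrite ltnS -addnn leq_addr.
  rewrite -[LHS]addn0; congr (_ + _)%N; apply/esym.
  rewrite big_nat_cond big1 // => i /andP[/andP[lt_ni _] _].
  by rewrite divn_small // (ltn_trans lt_ni) // ltn_expl // prime_gt1.
have lt_sum : (\sum_(1 <= i < n.*2.+1) (n %/ p ^ i + n %/ p ^ i)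
    < \sum_(1 <= i < n.*2.+1) n.*2 %/ p ^ i)%N.
  rewrite !(@big_cat_nat _ _ _ a 1 n.*2.+1) ?leqW //=.
  rewrite !(@big_nat_recl _ _ _ _ a) ?ltnS //=.
  have le_i i : (n %/ p ^ i + n %/ p ^ i <= n.*2 %/ p ^ i)%N.
    have pi0 : (0 < p ^ i)%N by rewrite expn_gt0 prime_gt0.
    by rewrite leq_divRL // mulnDl -addnn leq_add // leq_divM.
  have lt_a : (n %/ p ^ a + n %/ p ^ a < n.*2 %/ p ^ a)%N.
    by rewrite (divn_small lt_n) addn0 divn_gt0 // expn_gt0 prime_gt0.
  rewrite -addnS leq_add //; first exact: leq_sum.
  by rewrite -addSn leq_add //; apply: leq_sum.
move: lt_sum; rewrite big_split /= -ext -elog => lt_sum.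
have : (0 < logn p 'C(n.*2, n))%N by move: lt_sum; lia.
by rewrite logn_gt0 mem_primes => /and3P[].
Qed.

Lemma prime_power_dvd_smooth p a k : prime p -> (p ^ a <= 2 ^ k)%N ->
  (p ^ a %| smooth_multiple k)%N.
Proof.
move=> p_pr; elim: k a => [|k IH] a le_pk.
  case: a le_pk => [|a]; first by rewrite expn0 dvd1n.
  by move=> /(leq_trans (ltn_expl a.+1 (prime_gt1 p_pr))).
rewrite /smooth_multiple big_ord_recr /= -/(smooth_multiple k).
have [le_k|lt_k] := leqP (p ^ a) (2 ^ k); first exact/dvdn_mulr/IH.
case: a lt_k le_pk => [|a lt_k le_pk]; first by rewrite dvd1n.
(* As p >= 2, p ^ a is at most 2 ^ k and divides the earlier product; the remaining p divides the
   new binomial. *)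
rewrite expnSr dvdn_mul //.
  apply: IH; rewrite -(leq_pmul2l (prime_gt0 p_pr)) -expnS (leq_trans le_pk) //.
  by rewrite expnS leq_mul // prime_gt1.
apply: (@prime_dvd_central_bin p a.+1) => //.
by rewrite lt_k -mul2n -expnS.
Qed.

Lemma dvd_smooth_multiple n k : (0 < n <= 2 ^ k)%N -> (n %| smooth_multiple k)%N.
Proof.
case/andP=> n0 le_n; apply/dvdn_partP => // p; rewrite mem_primes => /and3P[p_pr _ _].
rewrite p_part; apply: prime_power_dvd_smooth => //.
by rewrite (leq_trans (dvdn_leq n0 (pfactor_dvdnn p n))).
Qed.

(** * Heights of sums and multiples *)

Section RationalHeight.
Implicit Types (z : rat) (n d : int).

Definition rat_height z : nat := maxn `|numq z| `|denq z|.

Lemma rat_height_gt0 z : (0 < rat_height z)%N.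
Proof. by rewrite leq_max !absz_gt0 denq_neq0 orbT. Qed.

Lemma rat_height_frac n d : d != 0 ->
  (rat_height (n%:~R / d%:~R)%R <= maxn `|n| `|d|)%N.
Proof.
move=> d0; set z : rat := _ / _.
have [k [en ek]] := frac_lowest_terms d0 (erefl z).
have k0 : (0 < `|k|)%N by rewrite absz_gt0; apply: contraNneq d0 => k0; rewrite ek k0 mul0r.
rewrite en ek !abszM -maxnMr leq_pmull //.
Qed.

Lemma absz_add (m n : int) : (`|(m + n)%R| <= `|m| + `|n|)%N.
Proof. by rewrite -lez_nat PoszD !abszE ler_normD. Qed.

Lemma rat_heightD z1 z2 :
  (rat_height (z1 + z2)%R <= 2 * rat_height z1 * rat_height z2)%N.
Proof.
have -> : z1 + z2 = (numq z1 * denq z2 + numq z2 * denq z1)%:~R / (denq z1 * denq z2)%:~R.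
  rewrite -{1}(divq_num_den z1) -{1}(divq_num_den z2) !(rmorphD, rmorphM) /=.
  by field; rewrite !intr_eq0 !denq_neq0.
apply: (leq_trans (rat_height_frac _ _)); first by rewrite mulf_neq0 ?denq_neq0.
have le_nh z : (`|numq z| <= rat_height z)%N by exact: leq_maxl.
have le_dh z : (`|denq z| <= rat_height z)%N by exact: leq_maxr.
rewrite geq_max; apply/andP; split.
  apply: (leq_trans (absz_add _ _)); rewrite !abszM -mulnA mul2n -addnn.
  by apply: leq_add; [|rewrite mulnC]; apply: leq_mul.
by rewrite abszM -mulnA (leq_trans _ (leq_pmull _ _)) // leq_mul.
Qed.

Lemma rat_heightM z1 z2 :
  (rat_height (z1 * z2)%R <= rat_height z1 * rat_height z2)%N.
Proof.
have -> : z1 * z2 = (numq z1 * numq z2)%:~R / (denq z1 * denq z2)%:~R.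
  rewrite -{1}(divq_num_den z1) -{1}(divq_num_den z2) !rmorphM /=.
  by field; rewrite !intr_eq0 !denq_neq0.
apply: (leq_trans (rat_height_frac _ _)); first by rewrite mulf_neq0 ?denq_neq0.
by rewrite !abszM geq_max !leq_mul ?leq_maxl ?leq_maxr.
Qed.

Lemma rat_heightN z : rat_height (- z) = rat_height z.
Proof. by rewrite /rat_height numqN denqN abszN. Qed.

Lemma rat_heightV z : (rat_height z^-1 <= rat_height z)%N.
Proof.
have [->|z0] := eqVneq z 0; first by rewrite invr0.
rewrite -{1}(divq_num_den z) invf_div.
by rewrite (leq_trans (rat_height_frac _ _)) ?numq_eq0 // maxnC.
Qed.

Lemma rat_height_nat (k : nat) : (0 < k)%N -> rat_height k%:R = k.
Proof.
move=> k0; rewrite /rat_height -[k%:R]/((k%:Z)%:~R) numq_int denq_int /=.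
exact/maxn_idPl.
Qed.

Section Bounded.
Variable Z : nat.
Hypothesis Z2 : (2 <= Z)%N.

(** Measuring all heights as powers of one Z makes exponents add up along an expression;
    [height_tac] infers them by unification. *)
Definition height_le (e : nat) z : Prop := (rat_height z <= Z ^ e)%N.

Lemma height_leW e e' z : height_le e z -> (e <= e')%N -> height_le e' z.
Proof. by move=> h le; apply: (leq_trans h); rewrite leq_pexp2l // ltnW. Qed.

Lemma height_leD e1 e2 z1 z2 : height_le e1 z1 -> height_le e2 z2 ->
  height_le (1 + e1 + e2) (z1 + z2).
Proof.
move=> h1 h2; apply: (leq_trans (rat_heightD _ _)).
by rewrite !expnD !leq_mul.
Qed.

Lemma height_leM e1 e2 z1 z2 : height_le e1 z1 -> height_le e2 z2 ->
  height_le (e1 + e2) (z1 * z2).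
Proof.
move=> h1 h2; apply: (leq_trans (rat_heightM _ _)).
by rewrite expnD leq_mul.
Qed.

Lemma height_leN e z : height_le e z -> height_le e (- z).
Proof. by rewrite /height_le rat_heightN. Qed.

Lemma height_leV e z : height_le e z -> height_le e z^-1.
Proof. exact/leq_trans/rat_heightV. Qed.

End Bounded.
End RationalHeight.

Ltac height_tac Z2 := lazymatch goal with
  | |- height_le _ _ (- _) => eapply height_leN; height_tac Z2
  | |- height_le _ _ (_ + _) => eapply (height_leD Z2); height_tac Z2
  | |- height_le _ _ (_ * _) => eapply height_leM; height_tac Z2
  | |- height_le _ _ (_^-1) => eapply height_leV; height_tac Z2
  | _ => eassumption
  end.

Lemma leq_expl m n e : (m <= n -> m ^ e <= n ^ e)%N.
Proof. by case: e => // e; rewrite leq_exp2r. Qed.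

Lemma leq_mulr_gt0 m n k : (m <= n -> 0 < k -> m <= n * k)%N.
Proof. by move=> h k0; rewrite (leq_trans h) // leq_pmulr. Qed.

Lemma leq_mull_gt0 m n k : (m <= n -> 0 < k -> m <= k * n)%N.
Proof. by move=> h k0; rewrite (leq_trans h) // leq_pmull. Qed.

(** * Heights of points under addition *)

Section PointHeight.
Variable E : weierstrass.
Implicit Types P Q : ec_point rat E.

Definition pt_height P : nat :=
  if sval P is Some (x, y) then (rat_height x * rat_height y)%N else 1%N.

Definition x_height P : nat :=
  if sval P is Some (x, _) then rat_height x else 1%N.

Lemma pt_height_gt0 P : (0 < pt_height P)%N.
Proof.
by rewrite /pt_height; case: (sval P) => [[x y]|] //; rewrite muln_gt0 !rat_height_gt0.
Qed.

Lemma x_height_gt0 P : (0 < x_height P)%N.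
Proof. by rewrite /x_height; case: (sval P) => [[x y]|] //; rewrite rat_height_gt0. Qed.

Lemma x_height_le P : (x_height P <= pt_height P)%N.
Proof.
rewrite /x_height /pt_height; case: (sval P) => [[x y]|] //.
by rewrite leq_pmulr ?rat_height_gt0.
Qed.

(** Bounds every constant in the addition formulas: the coefficients a1 to a4 and the numerals 2 and
    3. *)
Definition coef_height : nat :=
  (3 * (rat_height (a1 E)%:~R * (rat_height (a2 E)%:~R * (rat_height (a3 E)%:~R
   * rat_height (a4 E)%:~R))))%N.

Lemma pt_height_add : exists A, forall P Q,
  (pt_height (addp P Q) <= (coef_height * pt_height P * pt_height Q) ^ A)%N.
Proof.
(* The exponent 100 for the new abscissa plus 200 for the new ordinate, both rounded up. *)
exists 300%N => P Q.
set Z := (coef_height * pt_height P * pt_height Q)%N.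
have c0 (i : int) : (0 < rat_height i%:~R)%N := rat_height_gt0 _.
have hP := pt_height_gt0 P; have hQ := pt_height_gt0 Q.
have hc : (3 <= coef_height)%N by rewrite /coef_height leq_mulr_gt0 // !muln_gt0 !c0.
have hcP : (coef_height * pt_height P <= Z)%N by rewrite leq_mulr_gt0.
have hcZ : (coef_height <= Z)%N by rewrite (leq_trans _ hcP) // leq_mulr_gt0.
have Z3 : (3 <= Z)%N by apply: leq_trans hcZ.
have Z2 : (2 <= Z)%N by apply: ltnW.
have P1Z : (pt_height P <= Z)%N.
  by rewrite (leq_trans _ hcP) // leq_mull_gt0 // (leq_trans _ hc).
have Q1Z : (pt_height Q <= Z)%N.
  by rewrite leq_mull_gt0 // muln_gt0 hP (leq_trans _ hc).
have le1 m : (m <= Z)%N -> (m <= Z ^ 300)%N.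
  by move=> h; rewrite (leq_trans h) // -{1}(expn1 Z) leq_pexp2l // ltnW.
have n2 : height_le Z 1 2 by rewrite /height_le expn1 (@rat_height_nat 2).
have n3 : height_le Z 1 3 by rewrite /height_le expn1 (@rat_height_nat 3).
have k1 : height_le Z 1 (a1 E)%:~R.
  rewrite /height_le expn1 (leq_trans _ hcZ) // leq_mull_gt0 // leq_mulr_gt0 // !muln_gt0 !c0 //.
have k2 : height_le Z 1 (a2 E)%:~R.
  rewrite /height_le expn1 (leq_trans _ hcZ) // leq_mull_gt0 // leq_mull_gt0 //.
  by rewrite leq_mulr_gt0 // !muln_gt0 !c0.
have k3 : height_le Z 1 (a3 E)%:~R.
  by rewrite /height_le expn1 (leq_trans _ hcZ) // 3?leq_mull_gt0 // leq_mulr_gt0.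
have k4 : height_le Z 1 (a4 E)%:~R.
  by rewrite /height_le expn1 (leq_trans _ hcZ) // 4?leq_mull_gt0.
case eP: (sval P) => [[x1 y1]|]; last first.
  by rewrite (_ : addp P Q = Q) ?le1 //; apply: ec_point_inj; rewrite /= eP.
case eQ: (sval Q) => [[x2 y2]|]; last first.
  by rewrite (_ : addp P Q = P) ?le1 //; apply: ec_point_inj; rewrite /= eP eQ.
rewrite {1}/pt_height /= eP eQ /=; case: ifP => _; first by rewrite expn_gt0 ltnW.
have hx1 : height_le Z 1 x1.
  by rewrite /height_le expn1 (leq_trans _ P1Z) // /pt_height eP leq_mulr_gt0 ?rat_height_gt0.
have hy1 : height_le Z 1 y1.
  by rewrite /height_le expn1 (leq_trans _ P1Z) // /pt_height eP leq_mull_gt0 ?rat_height_gt0.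
have hx2 : height_le Z 1 x2.
  by rewrite /height_le expn1 (leq_trans _ Q1Z) // /pt_height eQ leq_mulr_gt0 ?rat_height_gt0.
have hy2 : height_le Z 1 y2.
  by rewrite /height_le expn1 (leq_trans _ Q1Z) // /pt_height eQ leq_mull_gt0 ?rat_height_gt0.
set lam := (if _ then _ else _).
have hlam : height_le Z 20 lam.
  by rewrite /lam !expr2; case: ifP => _;
    (eapply (height_leW Z2); [height_tac Z2 | ]).
set nu := y1 - _; have hnu : height_le Z 25 nu.
  by eapply (height_leW Z2); [rewrite /nu; height_tac Z2 | ].
rewrite !expr2; set x3 := lam * lam + _ - _ - _ - _; have hx3 : height_le Z 100 x3.
  by eapply (height_leW Z2); [rewrite /x3; height_tac Z2 | ].
set y3 := - _ * _ - _ - _; have hy3 : height_le Z 200 y3.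
  by eapply (height_leW Z2); [rewrite /y3; height_tac Z2 | ].
by rewrite -[300%N]/(100 + 200)%N expnD; apply: leq_mul.
Qed.

(* Binary expansion of m: doubling multiplies the logarithm of the height by a
   bounded factor, which makes it polynomial in m. *)
Lemma pt_height_mul (hE : (disc E)%:~R != 0 :> rat) : exists B, forall P m, (0 < m)%N ->
  (pt_height (iter m (addp P) (zerop rat E))
   <= (coef_height * pt_height P) ^ (m ^ B))%N.
Proof.
have [A hA] := pt_height_add; set c := coef_height.
have c0 : (0 < c)%N by rewrite /c /coef_height !muln_gt0 !rat_height_gt0.
(* Absorbing c turns the bound for a sum into a pure power of N P * N Q. *)
pose N P := (c * pt_height P)%N.
have N0 P : (0 < N P)%N by rewrite muln_gt0 c0 pt_height_gt0.
have NA P Q : (N (addp P Q) <= (N P * N Q) ^ A.+1)%N.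
  rewrite expnS leq_mul //.
    by rewrite /N -mulnA leq_mulr_gt0 // muln_gt0 pt_height_gt0 N0.
  apply: (leq_trans (hA P Q)); apply: leq_expl.
  by apply: leq_mul => //; rewrite /N leq_mull_gt0.
(* With q the half of m, one step needs (2 q ^ D (A + 1) + 1)(A + 1) <= (2 q) ^ D; the left side is
   at most D q ^ D, and D < 2 ^ D. *)
pose D := (3 * A.+1 ^ 2)%N; exists D => P m m0.
suff: (N (iter m (addp P) (zerop rat E)) <= N P ^ (m ^ D))%N.
  by apply: leq_trans; rewrite leq_mull_gt0.
elim/ltn_ind: m m0 => m IH m0.
have [lt_m1|lt_1m] := leqP m 1.
  have -> : m = 1%N by apply/eqP; rewrite eqn_leq lt_m1.
  by rewrite exp1n expn1 /= (addpC hE) add0p.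
set q := m./2; have q0 : (0 < q)%N by rewrite half_gt0.
have eq m1 m2 : iter (m1 + m2) (addp P) (zerop rat E)
    = addp (iter m1 (addp P) (zerop rat E)) (iter m2 (addp P) (zerop rat E)).
  by elim: m1 => [|m1 IHm]; rewrite ?add0p //= IHm (addpA hE).
have {}IH : (N (iter q (addp P) (zerop rat E)) <= N P ^ (q ^ D))%N.
  by apply: IH => //; rewrite /q ltn_half_double -addnn -[X in (X < _)%N]addn0 ltn_add2l.
have le2 : (N (iter q.*2 (addp P) (zerop rat E)) <= N P ^ (2 * q ^ D * A.+1))%N.
  rewrite -addnn eq; apply: (leq_trans (NA _ _)); rewrite expnM; apply: leq_expl.
  by rewrite mul2n -addnn expnD leq_mul.
have le_m : (N (iter m (addp P) (zerop rat E)) <= N P ^ ((2 * q ^ D * A.+1 + 1) * A.+1))%N.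
  have -> : m = (odd m + q.*2)%N by rewrite odd_double_half.
  case: (odd m); rewrite ?add0n ?add1n.
    rewrite /= (leq_trans (NA _ _)) // expnM; apply: leq_expl.
    by rewrite expnD expn1 mulnC leq_mul.
  rewrite (leq_trans le2) // leq_pexp2l //.
  by rewrite (leq_trans (leq_addr 1 _)) // leq_pmulr.
apply: (leq_trans le_m); rewrite leq_pexp2l //.
have le_q : (q.*2 ^ D <= m ^ D)%N.
  by rewrite leq_exp2r // -[X in (_ <= X)%N]odd_double_half leq_addl.
apply: (leq_trans _ le_q); rewrite -mul2n expnMn.
apply: (@leq_trans (D * q ^ D)); last by rewrite leq_mul // ltnW // ltn_expl.
have qD : (1 <= q ^ D)%N by rewrite expn_gt0 q0.
rewrite /D in qD *; nia.
Qed.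

End PointHeight.

(** * The canonical height *)

Section CanonicalHeight.
Variable E : weierstrass.
Implicit Types P Q : ec_point rat E.

Definition quartic (c0 c1 c2 c3 c4 n d : int) : int :=
  c0 * n ^+ 4 + c1 * (n ^+ 3 * d) + c2 * (n ^+ 2 * d ^+ 2) + c3 * (n * d ^+ 3)
  + c4 * d ^+ 4.

Lemma quartic_le (c0 c1 c2 c3 c4 n d : int) (h : nat) : (`|n| <= h)%N -> (`|d| <= h)%N ->
  (`|quartic c0 c1 c2 c3 c4 n d|
    <= (`|c0| + `|c1| + `|c2| + `|c3| + `|c4|) * h ^ 4)%N.
Proof.
move=> hn hd; rewrite /quartic !mulnDl.
have add a b (k l : int) : (`|k| <= a)%N -> (`|l| <= b)%N -> (`|(k + l)%R| <= a + b)%N.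
  by move=> hk hl; apply: (leq_trans (absz_add _ _)); apply: leq_add.
do 4 ?[apply: (add)]; rewrite !(abszM, abszX) leq_mul //.
- exact: leq_expl.
- by rewrite (expnSr h 3) leq_mul // leq_expl.
- by rewrite (expnD h 2 2) leq_mul // leq_expl.
- by rewrite (expnS h 3) leq_mul // leq_expl.
- exact: leq_expl.
Qed.

(** The duplication formula writes x(2P) as a quotient of two quartic forms in the numerator and
    denominator of x(P); cancellation can only lower the height. *)
Lemma x_height_double : exists2 C, (0 < C)%N &
  forall P, (x_height (addp P P) <= C * x_height P ^ 4)%N.
Proof.
pose C1 := (1 + 0 + `|- b4 E| + `|(- 2 * b6 E)%R| + `|(- b8 E)%R|)%N.
pose C2 := (0 + 4 + `|b2 E| + `|(2 * b4 E)%R| + `|b6 E|)%N.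
exists (C1 + C2)%N => // P.
have xh0 : (0 < (C1 + C2) * x_height P ^ 4)%N by rewrite muln_gt0 expn_gt0 x_height_gt0.
case eP: (sval P) => [[x y]|]; last first.
  by rewrite {1}/x_height (_ : addp P P = P) ?eP //; apply: ec_point_inj; rewrite /= eP.
have /on_curveP hP : on_curve E (Some (x, y)) by rewrite -eP (svalP P).
have hA6 : (a6 E)%:~R = y ^+ 2 + (a1 E)%:~R * x * y + (a3 E)%:~R * y - x ^+ 3
   - (a2 E)%:~R * x ^+ 2 - (a4 E)%:~R * x :> rat by rewrite hP; ring.
have [psi0|psi0] := eqVneq (y + y + (a1 E)%:~R * x + (a3 E)%:~R) 0.
  by rewrite {1}/x_height /= eP /= eqxx psi0 eqxx.
pose n := numq x; pose d := denq x.
have d0 : d%:~R != 0 :> rat by rewrite intr_eq0 denq_neq0.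
have ex : x = n%:~R / d%:~R by rewrite divq_num_den.
pose num := quartic 1 0 (- b4 E) (- 2 * b6 E) (- b8 E) n d.
pose den := quartic 0 4 (b2 E) (2 * b4 E) (b6 E) n d.
have psi0' : 2 * y + (a1 E)%:~R * x + (a3 E)%:~R != 0.
  by rewrite (_ : 2 * y = y + y) //; ring.
have eden : den%:~R = d%:~R ^+ 4 * (2 * y + (a1 E)%:~R * x + (a3 E)%:~R) ^+ 2 :> rat.
  transitivity (d%:~R ^+ 4 * (4 * x ^+ 3 + (b2 E)%:~R * x ^+ 2 + 2 * (b4 E)%:~R * x + (b6 E)%:~R) : rat).
    rewrite ex /den /quartic !(rmorphD, rmorphM, rmorphXn, rmorph0) /=; field.
    exact: d0.
  congr (_ * _); rewrite /b2 /b4 /b6 !(rmorphD, rmorphN, rmorphM, rmorphXn) /= hA6.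
  ring.
have den0 : den != 0 by rewrite -(intr_eq0 rat) eden mulf_neq0 // expf_neq0.
have [y3 e3] : exists y3, sval (addp P P) = Some (num%:~R / den%:~R, y3).
  rewrite /= eP /= eqxx (negPf psi0) /=; eexists; congr (Some (_, _)).
  apply: (mulIf (_ : den%:~R != 0)); rewrite ?intr_eq0 // divfK ?intr_eq0 //.
  have -> : num%:~R = d%:~R ^+ 4 * (x ^+ 4 - (b4 E)%:~R * x ^+ 2 - 2 * (b6 E)%:~R * x - (b8 E)%:~R) :> rat.
    rewrite ex /num /quartic !(rmorphD, rmorphN, rmorphM, rmorphXn, rmorph0, rmorph1) /=; field.
    exact: d0.
  rewrite eden mulrCA; congr (_ * _).
  rewrite /b4 /b6 /b8 !(rmorphD, rmorphN, rmorphM, rmorphXn) /= hA6.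
  by field.
rewrite {1}/x_height e3 (leq_trans (rat_height_frac _ den0)) // geq_max.
have hn : (`|n| <= x_height P)%N by rewrite /x_height eP leq_maxl.
have hd : (`|d| <= x_height P)%N by rewrite /x_height eP leq_maxr.
apply/andP; split; (apply: (leq_trans (quartic_le _ _ _ _ _ hn hd))).
  by rewrite leq_mul // leq_addr.
by rewrite leq_mul // leq_addl.
Qed.

Variable R : realType.

Lemma naive_heightE P : naive_height R P = ln (x_height P)%:R.
Proof.
rewrite /naive_height /x_height; case: (sval P) => [[x y]|]; last by rewrite ln1.
congr ln; rewrite /rat_height.
have -> : Num.max `|numq x| (denq x) = (maxn `|numq x| `|denq x|)%:Z.
  have -> : denq x = `|denq x|%N%:Z by rewrite gez0_abs // denq_ge0.
  by rewrite -abszE /maxn /Order.max -ltz_nat; case: ifP.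
by [].
Qed.

(* Only this upper bound is needed, so the convergence of Tate's limit is
   irrelevant: a divergent limit is the default value [point]. *)
Lemma canonical_height_le : exists C : R, 0 < C /\
  forall P, canonical_height R P <= C + ln (x_height P)%:R.
Proof.
have [C C0 hC] := x_height_double.
have CR : 1 <= C%:R :> R by rewrite (ler_nat _ 1).
exists (ln C%:R + `|point : R| + 1); split.
  by rewrite ltr_wpDl // addr_ge0 // ln_ge0.
move=> P; pose dbl (T : ec_point rat E) := addp T T.
(* Multiplying by C makes one doubling a plain fourth power, so division by 4 ^ n leaves a bound
   independent of n. *)
have hn n : (C * x_height (iter n dbl P) <= (C * x_height P) ^ (4 ^ n))%N.
  elim: n => [|n IH]; first by rewrite expn0 expn1.
  rewrite expnSr expnM; apply: leq_trans (leq_expl 4 IH).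
  rewrite expnMn (leq_trans (_ : _ <= C * (C * x_height (iter n dbl P) ^ 4))%N) //.
    by rewrite leq_mul // hC.
  rewrite mulnA leq_mul // -[X in (X <= _)%N]/(C ^ 2)%N leq_pexp2l //.
have xh0 Q : 1 <= (x_height Q)%:R :> R by rewrite (ler_nat _ 1) x_height_gt0.
have hx : 0 <= ln (x_height P)%:R :> R by apply: ln_ge0.
have hln n : naive_height R (iter n dbl P) / 4 ^+ n <= ln C%:R + ln (x_height P)%:R.
  rewrite naive_heightE ler_pdivrMr ?exprn_gt0 //.
  rewrite -lnM ?posrE ?(lt_le_trans ltr01) // -natrM -natrX mulr_natr.
  rewrite -lnXn; last by rewrite ltr0n muln_gt0 C0 x_height_gt0.
  rewrite ler_ln ?posrE ?(lt_le_trans ltr01) //; last first.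
    by rewrite -natrX ler1n expn_gt0 muln_gt0 C0 x_height_gt0.
  rewrite -natrX ler_nat (leq_trans _ (hn n)) // leq_pmull //.
rewrite /canonical_height -/dbl.
set u := (fun n => _).
have lim_le : lim (u @ \oo) <= ln C%:R + `|point : R| + ln (x_height P)%:R.
  have [cu|du] := pselect (cvg (u @ \oo)).
    apply: (@le_trans _ _ (ln C%:R + ln (x_height P)%:R)).
      by apply: limr_le => //; apply: nearW.
    by rewrite lerD2r lerDl.
  by rewrite (dvgP du); have := ler_norm (point : R); have := ln_ge0 CR; lra.
have h0 : 0 <= ln C%:R + `|point : R| + ln (x_height P)%:R.
  by rewrite !addr_ge0 // ln_ge0.
rewrite ler_pdivrMr // (le_trans lim_le) // mulr_natr mulr2n.
lra.
Qed.

End CanonicalHeight.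

(** * Multiples and their reductions *)

Section Multiples.
Variables (F : fieldType) (E : weierstrass) (hF : (disc E)%:~R != 0 :> F).
Local Notation G := (ec_group hF).

Lemma iter_addp (P : G) n : iter n (@addp F E P) (zerop F E) = P *+ n.
Proof. by elim: n => [|n IH]; rewrite ?mulr0n //= IH mulrS. Qed.

Lemma mulzpE (P : G) (n : int) : @mulzp F E n P = P *~ n.
Proof. by case: n => n; rewrite /mulzp iter_addp. Qed.

Lemma subgroup_mulrn (H : set G) (P : G) n : @subgroup F E H -> H P -> H (P *+ n).
Proof.
case=> H0 HD _ HP; elim: n => [|n IH]; first by rewrite mulr0n.
by rewrite mulrS; apply: HD.
Qed.

Lemma lin_indepE n (P : 'I_n -> G) : @lin_indep F E n P <->
  forall m : 'I_n -> int, \sum_(i < n) P i *~ m i = 0 -> forall i, m i = 0.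
Proof.
split=> h m hm; apply: h; rewrite -[RHS]hm; apply: eq_bigr => i _.
  exact: mulzpE.
by rewrite -mulzpE.
Qed.

Lemma lin_indep_torsion_free n (P : 'I_n -> G) i k :
  @lin_indep F E n P -> (0 < k)%N -> P i *+ k != 0.
Proof.
move=> /lin_indepE h k0; apply/eqP => Pk0.
have /h/(_ i) : \sum_(j < n) P j *~ (if j == i then k%:Z else 0) = 0.
  rewrite (bigD1 i) //= eqxx big1 ?addr0 // => j /negPf ->.
  by rewrite mulr0z.
by rewrite eqxx => -[k00]; rewrite k00 in k0.
Qed.

(** Otherwise each of r independent points has a positive multiple in Gamma, and s + 1 of these
    multiples would be independent. *)
Lemma exists_indep_point (Gamma : set G) r s :
  @has_rank F E [set: G] r -> @has_rank F E Gamma s -> (s < r)%N ->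
  exists P : G, forall m, (0 < m)%N -> ~ Gamma (P *+ m).
Proof.
move=> [[P' _ indP'] _] [_ maxG] lt_sr; apply: contrapT => noP.
move: (P' : 'I_r -> G) indP' => P indP {P'}.
have hm i : exists m, (0 < m)%N /\ Gamma (P i *+ m).
  apply: contrapT => hi; apply: noP; exists (P i) => m m0 Gm.
  by apply: hi; exists m.
have [m hmi] := choice hm.
pose w := widen_ord lt_sr.
apply: (maxG (fun i => P (w i) *+ m (w i))) => [i|]; first by have [] := hmi (w i).
apply/lin_indepE => n hn i.
pose k (j : 'I_r) : int := if (j < s.+1)%N then (m j)%:Z * n (inord j) else 0.
have /lin_indepE/(_ k) h := indP.
have kw j : k (w j) = (m (w j))%:Z * n j.
  by rewrite /k /= ltn_ord inord_val.
have : k (w i) = 0.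
  apply: h; rewrite -[RHS]hn.
  transitivity (\sum_(j < r | (j < s.+1)%N) P j *~ k j).
    rewrite [RHS]big_mkcond; apply: eq_bigr => j _; rewrite /k.
    by case: ifP => //; rewrite mulr0z.
  rewrite (big_ord_narrow lt_sr); apply: eq_bigr => j _.
  by rewrite kw mulrzA.
rewrite kw => /eqP; rewrite mulf_eq0 => /orP[|/eqP //].
by have [m0 _] := hmi (w i); rewrite eqz_nat eqn0Ngt m0.
Qed.

End Multiples.

(** * Multiples modulo a prime of good reduction *)

Section ReductionMultiples.
Variables (E : weierstrass) (p : nat).
Hypotheses (p_pr : prime p) (p_good : ~~ (p%:Z %| disc E)%Z).

Lemma good_disc_neq0 : (disc E)%:~R != 0 :> 'F_p.
Proof.
by rewrite -(dvdz_pcharf (pchar_Fp p_pr)).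
Qed.

Variable discQ : (disc E)%:~R != 0 :> rat.
Local Notation GQ := (ec_group discQ).
Local Notation GF := (ec_group good_disc_neq0).
Local Notation red := (reduce 'F_p : GQ -> GF).

Lemma reduce_mulrn (P : GQ) n : red (P *+ n) = red P *+ n.
Proof.
elim: n => [|n IH]; first by rewrite !mulr0n; exact: reduce_zero.
rewrite !mulrS -IH; exact: (reduce_add good_disc_neq0).
Qed.

Lemma reduce_subgroup_multiple (Gamma : set GQ) (P P0 : GQ) K :
  @subgroup rat E Gamma -> Gamma P0 -> (0 < K)%N ->
  (forall i, (0 < i < K)%N -> red (P0 *+ i) != 0) ->
  exists n, [/\ (0 < n)%N, (n * K <= p.*2.+1)%N & (red @` Gamma) (red (P *+ n))].
Proof.
move=> hG GP0 K0 hK; have [G0 GD GN] := hG.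
have := @multiple_in_subgroup GF _ _ (@pt_code_inj 'F_p E) (red @` Gamma) (red P) (red P0) K K0.
rewrite card_pt_code card_Fp //.
case.
- by exists 0 => //; exact: reduce_zero.
- move=> _ _ [x Gx <-] [y Gy <-]; exists (x - y); first by apply: GD => //; apply: GN.
  rewrite [LHS](reduce_add good_disc_neq0); congr (_ + _).
  exact: reduce_opp.
- by exists P0.
- by move=> i hi; rewrite -reduce_mulrn; apply: hK.
by move=> n [n0 nK hn]; exists n; split=> //; rewrite reduce_mulrn.
Qed.

(** p divides the denominator of the abscissa. Applied to multiples of P0, this bounds the primes at
    which P0 has small order. *)
Lemma reduce_zero_le (P : GQ) : P != 0 -> red P = 0 ->
  (p <= if sval P is Some (x, _) then `|denq x| else 0)%N.
Proof.
move=> P0 /(reduce_kernelP)[P00|]; first by rewrite P00 in P0; case/eqP: P0.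
move=> [x [y [-> x0 rx]]].
have : ((denq x)%:~R : 'F_p) == 0.
  case: (residue_dichotomy 'F_p x) => [[_ -> _]|[r rx']] //.
  case: (@residue_eq01 'F_p (x^-1 * x)); last by rewrite mulVf.
  by rewrite -(mul0r r); apply: residueM.
rewrite -(dvdz_pcharf (pchar_Fp p_pr)) => /dvdn_leq; apply.
by rewrite absz_gt0 denq_neq0.
Qed.

End ReductionMultiples.

(* For large p the order of P0 modulo p is at least 6D, so P has order at most
   p / 2D modulo Gamma_p; the finitely many other p are dealt with by a
   factorial. *)
Lemma exists_common_multiple (E : weierstrass) (discQ : (disc E)%:~R != 0 :> rat)
    (Gamma : set (ec_group discQ)) (P P0 : ec_group discQ) (D : nat) :
  @subgroup rat E Gamma -> Gamma P0 -> (forall i, (0 < i)%N -> P0 *+ i != 0) ->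
  (0 < D)%N -> exists2 M, (0 < M)%N & forall p k, prime p -> ~~ (p%:Z %| disc E)%Z ->
  (p < D * 2 ^ k.+1)%N ->
  (reduce 'F_p @` Gamma) (reduce 'F_p (P *+ (M * smooth_multiple k))).
Proof.
move=> hG GP0 infP0 D0.
pose den (Q : ec_group discQ) : nat := if sval Q is Some (x, _) then `|denq x|%N else 0%N.
pose N := (\sum_(i < 6 * D) den (P0 *+ i))%N.
(* For p <= N the pigeonhole principle is used with K = 1, where the condition on the order is void;
   it gives n <= 2 p + 1 <= 2 N + 1. *)
exists (N.*2.+1)`! => [|p k p_pr p_good lt_p]; first exact: fact_gt0.
suff [n n0 [ndvd [g Gg eg]]] : exists2 n, (0 < n)%N &
    (n %| (N.*2.+1)`! * smooth_multiple k)%N /\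
    (reduce 'F_p @` Gamma) (reduce 'F_p (P *+ n)).
  have /dvdnP[q ->] := ndvd; rewrite mulnC mulrnA.
  exists (g *+ q); first exact: (subgroup_mulrn q hG Gg).
  rewrite [RHS](reduce_mulrn p_pr p_good) -eg; exact: (reduce_mulrn p_pr p_good).
have [le_pN|lt_Np] := leqP p N.
  have [[|i] //|n [n0 n1 hn]] :=
    @reduce_subgroup_multiple _ _ p_pr p_good discQ Gamma P P0 1 hG GP0 isT.
  exists n => //; split=> //; apply: dvdn_mulr; apply: dvdn_fact; rewrite n0.
  by rewrite muln1 in n1; rewrite (leq_trans n1) // ltnS leq_double.
have D6 : (0 < 6 * D)%N by rewrite muln_gt0.
have [i /andP[i0 lt_i]|n [n0 nK hn]] :=
  @reduce_subgroup_multiple _ _ p_pr p_good discQ Gamma P P0 (6 * D)%N hG GP0 D6.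
  apply/eqP => /(@reduce_zero_le _ _ p_pr p_good discQ _ (infP0 i i0)); rewrite -/(den _) => le_p.
  suff : (p <= N)%N by rewrite leqNgt lt_Np.
  by rewrite (leq_trans le_p) // /N (bigD1 (Ordinal lt_i)) //= leq_addr.
exists n => //; split=> //; apply: dvdn_mull; apply: dvd_smooth_multiple; rewrite n0 /=.
have p1 := prime_gt1 p_pr; rewrite expnS in lt_p.
move: (2 ^ k)%N lt_p => q lt_p.
(* If n > q, then 6 D n > 4 D q, whereas 6 D n <= 2 p + 1 and p < 2 D q. *)
rewrite leqNgt; apply/negP => lt_qn.
have : (D * q.+1 <= D * n)%N by rewrite leq_mul.
have e1 : (n * (6 * D) = 6 * (D * n))%N by rewrite mulnCA mulnC [(n * D)%N]mulnC mulnC.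
have e2 : (D * (2 * q) = 2 * (D * q))%N by rewrite mulnCA.
rewrite e1 in nK; rewrite e2 in lt_p; rewrite mulnS.
by move: (D * n)%N (D * q)%N nK lt_p => x y; lia.
Qed.

Theorem theorem5 (R : realType) (E : weierstrass) (hE : disc E != 0)
    (r s : nat) (hr : (2 <= r)%N) (hrank : has_rank [set: ec_point rat E] r)
    (Gamma : set (ec_point rat E)) (hGamma : subgroup Gamma)
    (hs : (1 <= s)%N) (hsr : (s < r)%N) (hrankG : has_rank Gamma s) :
  exists C : R, \forall x \near +oo, exists Q : ec_point rat E,
    canonical_height R Q <= expR (4 / (s%:R + 2) * x + C * (x / ln x)) /\
    pseudolin_dep x Gamma Q.
Proof.
have discQ : (disc E)%:~R != 0 :> rat by rewrite intr_eq0.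
have [P hP] : exists P : ec_group discQ, forall m, (0 < m)%N -> ~ Gamma (P *+ m).
  exact: exists_indep_point hrank hrankG hsr.
have [P0 GP0 infP0] : exists2 P0 : ec_group discQ, Gamma P0 &
    forall i, (0 < i)%N -> P0 *+ i != 0.
  have [[b Gb indb] _] := hrankG.
  exists (b (Ordinal hs)); first exact: Gb.
  by move=> i i0; exact: (lin_indep_torsion_free (hF := discQ) _ indb i0).
have [C1 [C1_gt0 hC1]] := canonical_height_le E R.
have [B hB] := pt_height_mul discQ.
pose b := (coef_height E * pt_height (P : ec_point rat E))%N.
have b1 : 1 <= b%:R :> R.
  by rewrite ler1n /b muln_gt0 pt_height_gt0 /coef_height !muln_gt0 !rat_height_gt0.
pose c : R := 4 / (s%:R + 2).
have c0 : 0 < c by rewrite divr_gt0 // ltr_wpDl.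
(* Makes 4 ^ (B x / D) at most exp (c x / 2); the other half of the exponent is kept for the
   constants gathered in [c2]. *)
pose D := (Num.truncn (2 * B%:R * ln 4 / c)).+1.
have hD : 2 * B%:R * ln 4 <= D%:R * c.
  by rewrite -ler_pdivrMr // ltW // truncnS_gt.
have D0 : (0 < D)%N by [].
have [M M0 hM] := @exists_common_multiple E discQ Gamma P P0 D hGamma GP0 infP0 D0.
pose c2 : R := (C1 + ln b%:R) * M%:R ^+ B.
exists 0; near=> x; rewrite mul0r addr0 -/c.
have x_ge : 2 * c2 / c <= x by near: x; apply: nbhs_pinfty_ge; rewrite num_real.
have x_geD : D%:R <= x by near: x; apply: nbhs_pinfty_ge; rewrite num_real.
have x0 : 0 <= x by rewrite (le_trans _ x_geD).
(* 2 ^ k is the largest power of 2 up to t: every prime p <= x is below D * 2 ^ k.+1, as [hM]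
   requires, while the common multiple is at most 4 ^ (2 ^ k) <= 4 ^ t. *)
pose T := Num.truncn x; pose t := (T %/ D)%N; pose k := trunc_log 2 t.
have t0 : (0 < t)%N by rewrite divn_gt0 // truncn_ge_nat.
have /andP[k_le k_gt] := trunc_log_bounds (isT : (1 < 2)%N) t0; rewrite -/k in k_le k_gt.
have lt_T : (T < D * 2 ^ k.+1)%N.
  by rewrite (leq_trans (ltn_ceil T D0)) // mulnC leq_mul.
pose m := (M * smooth_multiple k)%N.
have m0 : (0 < m)%N by rewrite muln_gt0 M0 smooth_multiple_gt0.
exists (P *+ m); split; last first.
  split; first exact: hP.
  move=> p p_pr p_le p_good; apply: hM => //.
  by rewrite (leq_ltn_trans _ lt_T) // truncn_ge_nat.
apply: (le_trans (hC1 _)).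
have hx : (x_height (P *+ m : ec_point rat E) <= b ^ (m ^ B))%N.
  by rewrite (leq_trans (x_height_le _)) // -(iter_addp P m) hB.
have lnb : 0 <= ln b%:R :> R by rewrite ln_ge0.
have le_ln : ln (x_height (P *+ m : ec_point rat E))%:R <= ln b%:R * (m ^ B)%:R :> R.
  rewrite mulr_natr -lnXn ?(lt_le_trans ltr01) // -natrX.
  by rewrite ler_ln ?posrE ?ltr0n ?x_height_gt0 ?ler_nat // expn_gt0 -(ltr0n R) (lt_le_trans ltr01).
have mB1 : 1 <= (m ^ B)%:R :> R by rewrite ler1n expn_gt0 m0.
have le_m : (m ^ B)%:R <= M%:R ^+ B * 4 ^+ (t * B) :> R.
  rewrite natrX exprM -exprMn lerXn2r ?nnegrE ?mulr_ge0 ?exprn_ge0 //.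
  rewrite -natrX -natrM ler_nat leq_mul // (leq_trans (smooth_multiple_le k)) //.
  by rewrite leq_pexp2l.
have four : 4 ^+ (t * B) <= expR (c * x / 2) :> R.
  rewrite -[X in X ^+ _](@lnK R 4) ?posrE // -expRM_natl ler_expR.
  have tx : (t * D)%:R <= x.
    by rewrite (le_trans _ (_ : T%:R <= x)) ?truncn_le // ler_nat leq_divM.
  rewrite natrM in tx; rewrite natrM ler_pdivlMr //.
  have -> : t%:R * B%:R * ln 4 * 2 = t%:R * (2 * B%:R * ln 4) :> R by ring.
  apply: (le_trans (ler_wpM2l (ler0n R t) hD)).
  by rewrite mulrA mulrC ler_wpM2l // ltW.
(* From 1 + z <= exp z with z = c x / 2, which exceeds [c2] or equals it by the choice of x. *)
have c2_le : c2 <= expR (c * x / 2).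
  apply: (le_trans _ (expR_ge1Dx _)).
  by rewrite ler_wpDl // ler_pdivlMr // mulrC [c * x]mulrC -ler_pdivrMr.
have c1_ge0 : 0 <= C1 + ln b%:R by rewrite addr_ge0 // ltW.
rewrite [c * x]splitr expRD; apply: (@le_trans _ _ ((C1 + ln b%:R) * (m ^ B)%:R)).
  by rewrite mulrDl lerD // ler_peMr // ltW.
apply: (@le_trans _ _ ((C1 + ln b%:R) * (M%:R ^+ B * 4 ^+ (t * B)))).
  exact: ler_wpM2l.
rewrite mulrA; apply: ler_pM => //; first by rewrite mulr_ge0 // exprn_ge0.
Unshelve. all: by end_near.
Qed.
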